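(* Let $q>0$ and let $\kappa_q>0$ be a constant with property $(P_q)$ described in the context. Let $f\in L^2(\mathbb{R})$. (1) Assume that $(1+|\xi|)^{q/2}\widehat{f}(\xi)\in L^2(\mathbb{R})$. If $a\in\mathbb{R}$ is such that $f$ and its translate $f_a(t)=f(t-a)$ are orthogonal in $L^2(\mathbb{R})$, then $$ |a|^q\,\inf_{t_0\in\mathbb{R}}\int_{\mathbb{R}}|\xi-t_0|^{q}\,|\widehat{f}(\xi)|^2\,d\xi\;\geq\;\kappa_q\int_{\mathbb{R}}|f(t)|^2\,dt . $$ (2) Assume that $(1+|t|)^{q/2}f(t)\in L^2(\mathbb{R})$. If $\omega\in\mathbb{R}$ is such that $f$ and its modulation $f^{(\omega)}(t)=e^{2i\pi\omega t}f(t)$ are orthogonal in $L^2(\mathbb{R})$, then $$ |\omega|^q\,\inf_{t_0\in\mathbb{R}}\int_{\mathbb{R}}|t-t_0|^{q}\,|f(t)|^2\,dt\;\geq\;\kappa_q\int_{\mathbb{R}}|f(t)|^2\,dt . $$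
   Context: Functions are complex-valued. The Fourier transform is $\widehat{u}(\xi)=\int_{\mathbb{R}}u(t)e^{-2i\pi\xi t}\,dt$ for $u\in L^1(\mathbb{R})$, extended from $L^1\cap L^2$ to a unitary operator on $L^2(\mathbb{R})$ in the usual way. Two functions $f,g\in L^2(\mathbb{R})$ are orthogonal if $\int_{\mathbb{R}}f(t)\overline{g(t)}\,dt=0$. Property $(P_q)$ of a constant $\kappa_q>0$: for every non-negative $u\in L^1(\mathbb{R})$ that is not almost everywhere zero, $$ \Bigl(\inf\{\xi>0 : \widehat{u}(\xi)=0 \text{ or } \widehat{u}(-\xi)=0\}\Bigr)^q\;\inf_{t_0\in\mathbb{R}}\int_{\mathbb{R}}|t-t_0|^q\,u(t)\,dt\;\geq\;\kappa_q\int_{\mathbb{R}}u(t)\,dt , $$ with values in $[0,+\infty]$ and the infimum of the empty set equal to $+\infty$. For every $q>0$ such a constant $\kappa_q$ exists. *)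

(* Defs.v *)
From HB Require Import structures.
From mathcomp Require Import all_boot all_order all_algebra.
From mathcomp Require Import complex.
From mathcomp Require Import all_classical all_reals all_analysis.

Set Implicit Arguments.
Unset Strict Implicit.
Unset Printing Implicit Defensive.

Import Order.TTheory GRing.Theory Num.Theory.
Import numFieldNormedType.Exports.

Local Open Scope classical_set_scope.
Local Open Scope ring_scope.
Local Open Scope complex_scope.

Section defs.
Context {R : realType}.
Implicit Types (f g : R -> R[i]) (u : R -> R) (q : R).

Local Notation mu := (@lebesgue_measure R).

(* The modulus as an element of R; the norm `|z| of the library lives in R[i]. *)
Definition cmod (z : R[i]) : R := ComplexField.Normc.normc z.

Definition cmeasurable f : Prop :=
  measurable_fun [set: R] (fun t => complex.Re (f t)) /\
  measurable_fun [set: R] (fun t => complex.Im (f t)).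

Definition cintegral f : R[i] :=
  (\int[mu]_t complex.Re (f t)) +i* (\int[mu]_t complex.Im (f t)).

Definition cL1 f : Prop :=
  cmeasurable f /\ (\int[mu]_t (cmod (f t))%:E < +oo)%E.

Definition cL2 f : Prop :=
  cmeasurable f /\ (\int[mu]_t (cmod (f t) ^+ 2)%:E < +oo)%E.

Definition orthogonal_L2 f g : Prop :=
  cintegral (fun t => f t * (g t)^*) = 0.

(* e^{2 i pi x} *)
Definition cexp2pi (x : R) : R[i] := cos (2 * pi * x) +i* sin (2 * pi * x).

(* The Fourier integral, meaningful for integrable f. *)
Definition fourier f (xi : R) : R[i] :=
  cintegral (fun t => f t * cexp2pi (- (xi * t))).

(* g is (a representative of) the Fourier transform of the square-integrable
   function f: the extension by density, in the L2 norm, of the Fourier integral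
   on the intersection of L1 and L2. By Plancherel's theorem, for f in L2 such a
   g exists, and is unique up to almost everywhere equality. *)
Definition is_fourier_L2 f g : Prop :=
  cL2 g /\
  exists h : nat -> R -> R[i],
    [/\ forall n, cL1 (h n) /\ cL2 (h n),
        (\int[mu]_t (cmod (h n t - f t) ^+ 2)%:E)%E @[n --> \oo] --> 0%E
      & (\int[mu]_xi (cmod (fourier (h n) xi - g xi) ^+ 2)%:E)%E
          @[n --> \oo] --> 0%E].

Definition dispersion q u : \bar R :=
  ereal_inf (range (fun t0 : R => \int[mu]_t (`|t - t0| `^ q * u t)%:E)%E).

(* Infimum of the xi > 0 such that the Fourier transform of u vanishes at xi or
   at - xi; ereal_inf set0 is +oo. *)
Definition first_zero u : \bar R :=
  ereal_inf [set xi%:E | xi in [set xi : R | 0 < xi /\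
    (fourier (fun t => (u t)%:C) xi = 0 \/
     fourier (fun t => (u t)%:C) (- xi) = 0)]].

Definition property_P q (kappa : R) : Prop :=
  forall u : R -> R,
    mu.-integrable [set: R] (EFin \o u) ->
    (forall t, 0 <= u t) ->
    ~ {ae mu, forall t, u t = 0} ->
    (kappa%:E * \int[mu]_t (u t)%:E <= first_zero u `^ q * dispersion q u)%E.

Definition translate (a : R) f : R -> R[i] := fun t => f (t - a).

Definition modulate (w : R) f : R -> R[i] := fun t => cexp2pi (w * t) * f t.

End defs.

(* Main.v *)
(* An orthogonality relation is a zero of the Fourier transform of a non-negative
   function, to which the property of kappa applies.  For a modulation this is
   immediate: <f, f^(w)> is the Fourier transform of |f|^2 at w.  For a
   translation, <f, f_a> = 0 has to be turned into the vanishing at a of the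
   Fourier transform of |fhat|^2.  By polarization this follows from Plancherel
   applied to f + z f_a, whose transform is (1 + z e^(-2 i pi a xi)) fhat, for
   z = 1 and z = i.

   Plancherel is obtained for a real p in L1 by damping: the integral of
   e^(-c|xi|) |phat(xi)|^2 is the double integral of p(s) p(t) P_c(t - s) with P_c
   the Poisson kernel.  The inequality p(s) p(t) <= (p(s)^2 + p(t)^2) / 2 gives
   Bessel's inequality as c -> 0, and when p is bounded and almost everywhere
   continuous, dominated convergence gives equality.  Such functions are dense in
   L2, and Bessel's inequality carries the equality over to the whole of
   L1 n L2. *)

Require Import Defs.
From mathcomp Require Import all_boot all_order all_algebra.
From mathcomp Require Import complex.
From mathcomp Require Import all_classical all_reals all_analysis.
From mathcomp Require Import measurable_realfun.
From mathcomp Require Import ring lra.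

Import Order.TTheory GRing.Theory Num.Theory.
Import numFieldNormedType.Exports.

Set Implicit Arguments.
Unset Strict Implicit.
Unset Printing Implicit Defensive.

Local Open Scope classical_set_scope.
Local Open Scope ring_scope.
Local Open Scope complex_scope.

(** An element of L2 and its transform are tied together only by an approximating sequence, and what
    survives the limit here is the equality of two squared norms: a weighted Young inequality bounds
    each norm by the other up to a factor close to 1. This is why every identity is stated for norms
    and the scalar product is recovered by polarization only at the very end. Working with real p
    keeps the double integral real: it involves only the cosine kernel, and the comparison of p(s)
    p(t) with squares is pointwise. The damping e^(-c|xi|) is chosen because its cosine transform
    comes from an explicit antiderivative, and the resulting kernel is positive, symmetric and of
    mass 1, which are the three facts that Bessel's inequality uses. Continuity is asked only almost
    everywhere so that the approximants may be cut off sharply outside an interval. Property (P_q)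
    concerns zeros of a genuine Fourier integral; it is applied to |fhat|^2, which is integrable and
    whose transform therefore has a value at the point a. *)

(** * Affine changes of variable in the Lebesgue integral *)

Section affine_change_of_variables.
Context {R : realType}.
Local Notation mu := (@lebesgue_measure R).
Variables (c d : R) (c_gt0 : 0 < c).

Let phi (x : R) : R := c * x + d.

Lemma measurable_affine (e b : R) (D : set R) :
  measurable_fun D (fun x : R => e * x + b).
Proof.
by apply: measurable_funD => //.
Qed.

Let mphi : measurable_fun [set: measurableTypeR R] (phi : _ -> measurableTypeR R).
Proof. exact: measurable_affine. Qed.

Let nu := mscale (NngNum (ltW c_gt0))
  (measure_function_pushforward__canonical__measure_function_Measure mu mphi).

(** By uniqueness of Lebesgue measure, half-open intervals suffice: the preimage of []a, b]] has
    length (b - a) / c, and the scaling in [nu] restores the factor c. *)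
Lemma lebesgue_measure_affine (A : set R) : measurable A ->
  mu A = (c%:E * mu ((fun x => (c * x + d)%R) @^-1` A))%E.
Proof.
move=> mA.
rewrite -[RHS]/(nu A).
apply: lebesgue_measure_unique => //= _ [[a b]] _ <- /=.
rewrite /nu /mscale/= /pushforward.
have -> : phi @^-1` `]a, b] = `](a - d) / c, (b - d) / c]%classic.
  apply/seteqP; split=> x /=; rewrite !in_itv/= /phi ltr_pdivrMr// ler_pdivlMr//
    ltrBlDr lerBrDr [x * c]mulrC//.
rewrite !lebesgue_measure_itv/= !lte_fin ltr_pM2r ?invr_gt0// ltrD2r.
case: ifPn => ab; last by rewrite mule0.
rewrite -!EFinB -EFinM; congr EFin.
by field; rewrite gt_eqF.
Qed.

Lemma ge0_integral_affine (f : R -> \bar R) :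
  measurable_fun [set: R] f -> (forall x, 0 <= f x)%E ->
  (\int[mu]_x f x = c%:E * \int[mu]_x f (c * x + d)%R)%E.
Proof.
move=> mf f0.
rewrite (@eq_measure_integral _ _ _ _ nu); last first.
  by move=> A mA _; exact: lebesgue_measure_affine.
rewrite ge0_integral_mscale//.
by rewrite (ge0_integral_pushforward mphi).
Qed.

Lemma integrable_affine (f : R -> \bar R) :
  mu.-integrable [set: R] f -> mu.-integrable [set: R] (fun x => f (c * x + d)%R).
Proof.
move=> /integrableP[mf ifoo]; apply/integrableP; split.
  exact: (measurableT_comp mf mphi).
have mabs : measurable_fun [set: R] (fun x => `|f x|%E) by exact: measurableT_comp.
have := ge0_integral_affine mabs (fun x => abse_ge0 _).
move=> H; rewrite H in ifoo; move: ifoo.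
apply: contraTT; rewrite -!leNgt !leye_eq => /eqP ->.
by rewrite gt0_muley.
Qed.

Lemma integral_affine (f : R -> \bar R) : mu.-integrable [set: R] f ->
  (\int[mu]_x f x = c%:E * \int[mu]_x f (c * x + d)%R)%E.
Proof.
move=> intf.
have mf := measurable_int mu intf.
have := integrable_affine intf => ig.
rewrite integralE [in RHS]integralE.
rewrite ge0_integral_affine; [|exact: measurable_funepos|by []].
rewrite [X in (_ - X)%E]ge0_integral_affine; [|exact: measurable_funeneg|by []].
have := integrable_pos_fin_num measurableT ig.
have := integrable_neg_fin_num measurableT ig.
rewrite funepos_comp funeneg_comp => nf pf.
by rewrite [RHS]muleBr//; exact: fin_num_adde_defr.
Qed.

End affine_change_of_variables.

(** * The cosine transform of e^(-c|x|) *)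

Section laplace_kernel.
Context {R : realType}.
Local Notation mu := (@lebesgue_measure R).

Lemma continuous_expRN_norm (c : R) : continuous (fun x : R => expR (- (c * `|x|))).
Proof.
move=> x; apply: (@continuous_comp _ _ _ (fun x : R => - (c * `|x|)) expR).
  apply: cvgN; apply: cvgM; first exact: cvg_cst.
  exact: norm_continuous.
exact: continuous_expR.
Qed.

(* Antiderivative of [e^(-c x) (1 + cos (b x))]; the summand 1 makes the integrand
   non-negative, as the fundamental theorem on a half-line requires. *)
Let F (c b x : R) : R := expR (- (c * x)) *
  ((b * sin (b * x) - c * cos (b * x)) / (c ^+ 2 + b ^+ 2) - c^-1).

Let is_derive_F (c b : R) (x : R) : 0 < c ->
  is_derive x (1:R) (F c b) (expR (- (c * x)) * (1 + cos (b * x))).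
Proof.
move=> c0; rewrite /F.
apply: is_derive_eq; rewrite /GRing.scale/=.
by field; rewrite (gt_eqF c0) gt_eqF// ltr_pwDl ?exprn_gt0 ?sqr_ge0.
Qed.

Let cvgy_F (c b : R) : 0 < c -> F c b x @[x --> +oo] --> (0 : R).
Proof.
move=> c0; pose M := c^-1 + (`|b| + c) / (c ^+ 2 + b ^+ 2).
have d0 : 0 < c ^+ 2 + b ^+ 2 by rewrite ltr_pwDl ?exprn_gt0 ?sqr_ge0.
have e0 : M * expR (- (c * x)) @[x --> +oo] --> (0 : R).
  rewrite -[X in _ --> X](mulr0 M); apply: cvgM; first exact: cvg_cst.
  apply: (@cvg_comp _ _ _ (fun x : R => c * x) (fun x => expR (- x)) _ +oo).
    exact: gt0_cvgMry.
  exact: cvgr_expR.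
have F_le x : `|F c b x| <= M * expR (- (c * x)).
  rewrite /F normrM mulrC (ger0_norm (expR_ge0 _)) ler_wpM2r ?expR_ge0//.
  rewrite (le_trans (ler_normB _ _))// addrC (@gtr0_norm _ c^-1) ?invr_gt0//.
  rewrite lerD2l normrM (@gtr0_norm _ _^-1) ?invr_gt0//.
  rewrite ler_pM2r ?invr_gt0// (le_trans (ler_normB _ _))// lerD//.
    by rewrite normrM ler_piMr// ler_norml sin_geN1 sin_le1.
  by rewrite normrM (gtr0_norm c0) ler_piMr ?(ltW c0)// ler_norml cos_geN1 cos_le1.
apply: (@squeeze_cvgr _ _ _ _ (fun x => - (M * expR (- (c * x)))) _ _ _ _ _ e0).
  by near=> x; rewrite -ler_norml.
by rewrite -[X in _ --> X]oppr0; exact: cvgN.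
Unshelve. all: by end_near. Qed.

(** The integrand is even and [F c b] tends to 0 at infinity, so the value is [- 2 * F c b 0]. *)
Lemma integral_expRN_norm_1Dcos (c b : R) : 0 < c ->
  (\int[mu]_x (expR (- (c * `|x|)) * (1 + cos (b * x)))%:E =
   (2 / c + 2 * c / (c ^+ 2 + b ^+ 2))%:E)%E.
Proof.
move=> c0.
have cf : continuous (fun x : R => expR (- (c * `|x|)) * (1 + cos (b * x))).
  move=> x; apply: cvgM; first exact: continuous_expRN_norm.
  apply: cvgD; first exact: cvg_cst.
  apply: (@continuous_comp _ _ _ (fun x : R => b * x) cos).
    by apply: cvgM; [exact: cvg_cst|exact: cvg_id].
  exact: continuous_cos.
rewrite ge0_symfun_integralT//.
- rewrite -set_itvcy.
  rewrite (@ge0_continuous_FTC2y _ _ (F c b) _ 0)//.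
  + rewrite /F !mulr0 oppr0 expR0 sin0 cos0.
    rewrite -EFinB -EFinM; congr EFin; field.
    by rewrite (gt_eqF c0) gt_eqF// ltr_pwDl ?exprn_gt0 ?sqr_ge0.
  + exact: continuous_subspaceT.
  + exact: cvgy_F.
  + apply: cvg_at_right_filter; apply/differentiable_continuous/derivable1_diffP.
    by have ? := is_derive_F b 0 c0; exact: ex_derive.
  + move=> x; rewrite in_itv/= andbT => x0.
    by have ? := is_derive_F b x c0; rewrite derive1E derive_val gtr0_norm.
- by move=> x /=; rewrite normrN mulrN cosN.
Qed.

(** The case b = 0 of the previous integral, whose integrand is then twice this one. *)
Lemma integral_expRN_norm (c : R) : 0 < c ->
  (\int[mu]_x (expR (- (c * `|x|)))%:E = (2 / c)%:E)%E.
Proof.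
move=> c0; have := integral_expRN_norm_1Dcos 0 c0.
under eq_integral do rewrite mul0r cos0 mulrC EFinM.
rewrite ge0_integralZl_EFin//; last first.
  apply/measurable_EFinP; apply: continuous_measurable_fun.
  exact: continuous_expRN_norm.
rewrite expr0n addr0 => h.
have -> : (2 / c)%:E = (2^-1%:E * (2 / c + 2 * c / c ^+ 2)%:E)%E.
  by rewrite -EFinM; congr EFin; field; rewrite gt_eqF.
by rewrite -h muleA -EFinM (_ : 2^-1 * _ = 1) ?mul1e//; field.
Qed.

Lemma integrable_expRN_norm (c : R) : 0 < c ->
  mu.-integrable [set: R] (fun x => (expR (- (c * `|x|)))%:E).
Proof.
move=> c0; apply/integrableP; split.
  apply/measurable_EFinP; apply: continuous_measurable_fun.
  exact: continuous_expRN_norm.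
under eq_integral do rewrite gee0_abs ?lee_fin ?expR_ge0//.
by rewrite integral_expRN_norm// ltry.
Qed.

Lemma integral_expRN_norm_cos (c b : R) : 0 < c ->
  (\int[mu]_x (expR (- (c * `|x|)) * cos (b * x))%:E =
   (2 * c / (c ^+ 2 + b ^+ 2))%:E)%E.
Proof.
move=> c0.
have mcos : measurable_fun [set: R] (fun x : R => cos (b * x)).
  apply: continuous_measurable_fun => x.
  apply/differentiable_continuous/derivable1_diffP; exact: ex_derive.
have int : mu.-integrable [set: R]
    (fun x : R => (expR (- (c * `|x|)) * cos (b * x))%:E).
  apply: le_integrable (integrable_expRN_norm c0) => //.
    apply/measurable_EFinP/measurable_funM => //.
    exact: continuous_measurable_fun (@continuous_expRN_norm c).
  move=> x _; rewrite /= lee_fin normrM ler_piMr// ler_norml.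
  by rewrite cos_geN1 cos_le1.
have := integral_expRN_norm_1Dcos b c0.
under eq_integral do rewrite mulrDr mulr1 EFinD.
rewrite integralD_EFin//=; last exact: integrable_expRN_norm.
(* The known integral of the summand 1 is now subtracted; cancellation among extended reals requires
   the cosine integral to be finite. *)
rewrite integral_expRN_norm// -(fineK (integrable_fin_num measurableT int)).
by rewrite -EFinD => -[/addrI ->].
Qed.

End laplace_kernel.

(** * The Poisson kernel *)

Section poisson_kernel.
Context {R : realType}.
Local Notation mu := (@lebesgue_measure R).

(* The Fourier transform of [e^(-c |xi|)]. *)
Definition poisson (c x : R) : R := 2 * c / (c ^+ 2 + (2 * pi * x) ^+ 2).

(** The Cauchy probability density, the common profile of all Poisson kernels: [poisson c] is this
    function at the scale c / (2 pi). *)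
Definition cauchy_density (y : R) : R := (pi * oneDsqr y)^-1.

Lemma continuous_cauchy_density : continuous cauchy_density.
Proof.
move=> y; rewrite /cauchy_density.
under eq_fun do rewrite invfM.
apply: cvgM; first exact: cvg_cst.
exact: continuous_oneDsqrV.
Qed.

Lemma cauchy_density_ge0 y : 0 <= cauchy_density y.
Proof. by rewrite invr_ge0 mulr_ge0 ?pi_ge0. Qed.

Lemma integral_cauchy_density : (\int[mu]_y (cauchy_density y)%:E = 1)%E.
Proof.
rewrite ge0_symfun_integralT.
- rewrite -set_itvcy /cauchy_density.
  under eq_integral do rewrite invfM EFinM.
  have pi0 : 0 <= pi^-1 :> R by rewrite invr_ge0 pi_ge0.
  have mV : measurable_fun (`[0%R, +oo[%classic : set R) (fun y : R => (oneDsqr y)^-1%:E).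
    apply/measurable_EFinP/measurable_funTS; apply: continuous_measurable_fun.
    exact: continuous_oneDsqrV.
  rewrite ge0_integralZl_EFin//.
  rewrite integral0y_oneDsqr -!EFinM; congr EFin.
  have : pi != 0 :> R by rewrite gt_eqF// pi_gt0.
  by move: pi => p p0; field.
- exact: cauchy_density_ge0.
- exact: continuous_cauchy_density.
- by move=> y; rewrite /cauchy_density/= /oneDsqr sqrrN.
Qed.

Lemma poisson_scale (c y : R) : 0 < c ->
  poisson c (c / (2 * pi) * y) = 2 * pi / c * cauchy_density y.
Proof.
move=> c0; rewrite /poisson /cauchy_density /oneDsqr.
have y0 : 1 + y ^+ 2 != 0 by rewrite gt_eqF// ltr_pwDl// sqr_ge0.
have : pi != 0 :> R by rewrite gt_eqF// pi_gt0.
move: pi => p p0; field.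
by rewrite y0 p0 (gt_eqF c0) gt_eqF// ltr_pwDl ?exprn_gt0 ?sqr_ge0.
Qed.

Lemma continuous_poisson c : 0 < c -> continuous (poisson c).
Proof.
move=> c0 x; apply: cvgM; first exact: cvg_cst.
apply: cvgV; first by rewrite gt_eqF// ltr_pwDl ?exprn_gt0 ?sqr_ge0.
have : derivable (fun y : R => c ^+ 2 + (2 * pi * y) ^+ 2) x 1.
  exact: ex_derive.
by move/derivable1_diffP/differentiable_continuous.
Qed.

Lemma measurable_poisson c : 0 < c -> measurable_fun [set: R] (poisson c).
Proof. by move=> c0; apply: continuous_measurable_fun; exact: continuous_poisson. Qed.

Lemma poisson_ge0 c x : 0 < c -> 0 <= poisson c x.
Proof.
by move=> c0; rewrite divr_ge0// ?mulr_ge0 ?ltW// ltr_pwDl ?exprn_gt0 ?sqr_ge0.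
Qed.

Lemma poissonB c x y : poisson c (x - y) = poisson c (y - x).
Proof. by rewrite /poisson -opprB mulrN sqrrN. Qed.

(** The substitution t = c y / (2 pi) + s leads to the Cauchy density, whatever c and s. The mass
    being exactly 1 gives the constant 1 in Bessel's inequality. *)
Lemma integral_poisson_shift (c s : R) : 0 < c ->
  (\int[mu]_t (poisson c (t - s))%:E = 1)%E.
Proof.
move=> c0.
have c1 : 0 < c / (2 * pi) by rewrite divr_gt0// mulr_gt0// pi_gt0.
have mP : measurable_fun [set: R] (fun t => (poisson c (t - s))%:E).
  apply/measurable_EFinP; apply: (measurableT_comp (measurable_poisson c0)).
  exact: measurable_funB.
rewrite (ge0_integral_affine s c1 mP); last first.
  by move=> t; rewrite lee_fin poisson_ge0.
under eq_integral do rewrite addrK poisson_scale// EFinM.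
have mC : measurable_fun [set: R] (fun y : R => (cauchy_density y)%:E).
  apply/measurable_EFinP; apply: continuous_measurable_fun.
  exact: continuous_cauchy_density.
have k0 : 0 <= 2 * pi / c by rewrite divr_ge0 ?mulr_ge0 ?pi_ge0 ?ltW.
rewrite ge0_integralZl_EFin//; last first.
  by move=> y _; rewrite lee_fin cauchy_density_ge0.
rewrite integral_cauchy_density mule1 -EFinM.
have : pi != 0 :> R by rewrite gt_eqF// pi_gt0.
by move: pi => p p0; congr EFin; field; rewrite p0 gt_eqF.
Qed.

Lemma integral_expRN_norm_poisson (c x : R) : 0 < c ->
  (\int[mu]_xi (expR (- (c * `|xi|)) * cos (2 * pi * xi * x))%:E = (poisson c x)%:E)%E.
Proof.
move=> c0; rewrite /poisson -(integral_expRN_norm_cos _ c0).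
by apply: eq_integral => xi _; rewrite mulrAC.
Qed.

End poisson_kernel.

(** * Integrals depending on a parameter, and Fubini under a product bound *)

Section parametric_integrals.
Context {R : realType}.
Local Notation mu := (@lebesgue_measure R).

Lemma ge0_measurable_integral_param (F : R * R -> \bar R) :
  measurable_fun [set: R * R] F -> (forall z, 0 <= F z)%E ->
  measurable_fun [set: R] (fun x => \int[mu]_y F (x, y))%E.
Proof. by move=> /(measurable_fun_fubini_tonelli_F (m2 := mu)) + F0; apply. Qed.

(** Tonelli's theorem gives the measurability for the positive and the negative part of [F]; the
    extended integral is their difference, and [fine] is measurable. *)
Lemma measurable_Rintegral_param (F : R * R -> R) :
  measurable_fun [set: R * R] F ->
  measurable_fun [set: R] (fun x => \int[mu]_y F (x, y)).
Proof.
move=> mF; have mEF : measurable_fun [set: R * R] (EFin \o F).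
  exact/measurable_EFinP.
apply: measurableT_comp; first exact: fine_measurable.
rewrite [X in measurable_fun _ X](_ : _ =
    (fun x => \int[mu]_y (EFin \o F)^\+ (x, y))%E
    \- (fun x => \int[mu]_y (EFin \o F)^\- (x, y))%E)%E; last first.
  apply/funext => x; rewrite integralE.
  by congr (_ - _)%E; apply: eq_integral => y _; rewrite !unlock.
apply: emeasurable_funB.
- by apply: ge0_measurable_integral_param => //; exact: measurable_funepos.
- by apply: ge0_measurable_integral_param => //; exact: measurable_funeneg.
Qed.

Section dominated_by_product.
Variables (F : R * R -> R) (a b : R -> R).
Hypotheses (mF : measurable_fun [set: R * R] F)
  (ia : mu.-integrable [set: R] (EFin \o a))
  (ib : mu.-integrable [set: R] (EFin \o b))
  (Fab : forall x y, `|F (x, y)| <= a x * b y).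

(** The product dominates an absolute value, so it is non-negative whatever the signs of the two
    factors. *)
Let absab x y : a x * b y = `|a x| * `|b y|.
Proof. by rewrite -normrM ger0_norm// (le_trans _ (Fab x y)). Qed.

Lemma integrable_prod_dominated :
  (mu \x mu)%E.-integrable [set: R * R] (EFin \o F).
Proof.
have mEF : measurable_fun [set: R * R] (EFin \o F) by exact/measurable_EFinP.
apply/integrable12ltyP => //.
have /integrableP[_] := integrable_abse ia.
have /integrableP[_] := integrable_abse ib.
under eq_integral do rewrite abse_id.
under [in X in _ -> X -> _]eq_integral do rewrite abse_id.
move=> ib' ia'.
have ma := measurable_int mu (integrable_abse ia).
have mb := measurable_int mu (integrable_abse ib).
apply: (@le_lt_trans _ _
    (\int[mu]_x (`|(a x)%:E| * \int[mu]_y `|(b y)%:E|))%E).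
  apply: ge0_le_integral => //.
  - by move=> x _; exact: integral_ge0.
  - apply: (@ge0_measurable_integral_param (abse \o (EFin \o F))).
      exact: measurableT_comp.
    by move=> z; exact: abse_ge0.
  - by apply: emeasurable_funM => //; exact: measurable_cst.
  - move=> x _; rewrite -ge0_integralZl//.
    apply: ge0_le_integral => //.
    + apply: measurableT_comp => //; apply: (measurableT_comp mEF).
      exact: measurable_pair1.
    + by apply: emeasurable_funM => //; exact: measurable_cst.
    + by move=> y _; rewrite -EFinM lee_fin -absab; exact: Fab.
have a0 : (0 <= \int[mu]_x `|(a x)%:E|)%E by exact: integral_ge0.
have b0 : (0 <= \int[mu]_y `|(b y)%:E|)%E by exact: integral_ge0.
rewrite ge0_integralZr//.
by apply: lte_mul_pinfty => //; rewrite ge0_fin_numE.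
Qed.

Lemma integrable_section1 x : mu.-integrable [set: R] (fun y => (F (x, y))%:E).
Proof.
apply: (@le_integrable _ _ _ mu _ measurableT _ (fun y => (a x * b y)%:E)) => //.
- by apply/measurable_EFinP; apply: (measurableT_comp mF); exact: measurable_pair1.
- by move=> y _; rewrite /= lee_fin (le_trans (Fab x y))// ler_norm.
- by under eq_fun do rewrite EFinM; exact: integrableZl.
Qed.

Lemma integrable_section2 y : mu.-integrable [set: R] (fun x => (F (x, y))%:E).
Proof.
apply: (@le_integrable _ _ _ mu _ measurableT _ (fun x => (b y * a x)%:E)) => //.
- by apply/measurable_EFinP; apply: (measurableT_comp mF); exact: measurable_pair2.
- by move=> x _; rewrite /= lee_fin mulrC (le_trans (Fab x y))// ler_norm.
- by under eq_fun do rewrite EFinM; exact: integrableZl.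
Qed.

(** The product bound makes every section integrable, not merely almost every one, so that [fine]
    loses nothing at any value of the parameter and Fubini's theorem passes to real integrals. *)
Lemma Rintegral_fubini :
  \int[mu]_x (\int[mu]_y F (x, y)) = \int[mu]_y (\int[mu]_x F (x, y)).
Proof.
rewrite /Rintegral; congr fine.
under eq_integral do
  rewrite (fineK (integrable_fin_num measurableT (integrable_section1 _))).
under [RHS]eq_integral do
  rewrite (fineK (integrable_fin_num measurableT (integrable_section2 _))).
exact: (Fubini integrable_prod_dominated).
Qed.

Lemma integrable_Rintegral_param :
  mu.-integrable [set: R] (fun x => (\int[mu]_y F (x, y))%:E).
Proof.
have := integrable_fubini_F integrable_prod_dominated.
congr (_.-integrable _ _); apply/funext => x.
by rewrite /Rintegral fineK// (integrable_fin_num measurableT (integrable_section1 _)).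
Qed.

End dominated_by_product.
End parametric_integrals.

(** * Cosine and sine transforms, and the damped energy of a real function *)

Section real_fourier.
Context {R : realType}.
Local Notation mu := (@lebesgue_measure R).
Implicit Types p : R -> R.

(** For real p the Fourier transform is [cosint p] - i [sinint p], so |phat|^2 is the sum of the two
    squares. *)
Definition cosint p (xi : R) : R := \int[mu]_t (p t * cos (2 * pi * (xi * t))).
Definition sinint p (xi : R) : R := \int[mu]_t (p t * sin (2 * pi * (xi * t))).

Lemma measurable_cos : measurable_fun [set: R] (@cos R).
Proof. by apply: continuous_measurable_fun; exact: continuous_cos. Qed.

Lemma measurable_sin : measurable_fun [set: R] (@sin R).
Proof. by apply: continuous_measurable_fun; exact: continuous_sin. Qed.

Lemma measurable_phase d (T : measurableType d) (u v : T -> R) :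
  measurable_fun [set: T] u -> measurable_fun [set: T] v ->
  measurable_fun [set: T] (fun z => 2 * pi * (u z * v z)).
Proof.
by move=> mu_ mv; apply: measurable_funM => //; exact: measurable_funM.
Qed.

Lemma integrable_mul_cos p (g : R -> R) : mu.-integrable [set: R] (EFin \o p) ->
  measurable_fun [set: R] g ->
  mu.-integrable [set: R] (fun t => (p t * cos (g t))%:E).
Proof.
move=> ip mg; have /measurable_EFinP mp := measurable_int mu ip.
apply: le_integrable ip => //.
  apply/measurable_EFinP; apply: measurable_funM => //.
  exact: (measurableT_comp measurable_cos).
by move=> t _; rewrite /= lee_fin normrM ler_piMr// ler_norml cos_geN1 cos_le1.
Qed.

Lemma integrable_mul_sin p (g : R -> R) : mu.-integrable [set: R] (EFin \o p) ->
  measurable_fun [set: R] g ->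
  mu.-integrable [set: R] (fun t => (p t * sin (g t))%:E).
Proof.
move=> ip mg; have /measurable_EFinP mp := measurable_int mu ip.
apply: le_integrable ip => //.
  apply/measurable_EFinP; apply: measurable_funM => //.
  exact: (measurableT_comp measurable_sin).
by move=> t _; rewrite /= lee_fin normrM ler_piMr// ler_norml sin_geN1 sin_le1.
Qed.

Lemma measurable_phasel (xi : R) :
  measurable_fun [set: R] (fun t : R => 2 * pi * (xi * t)).
Proof. by apply: measurable_phase => //; exact: measurable_cst. Qed.
Hint Resolve measurable_phasel : core.

Lemma measurable_cosint p : measurable_fun [set: R] p ->
  measurable_fun [set: R] (cosint p).
Proof.
move=> mp.
apply: (measurable_Rintegral_param
  (F := fun z => p z.2 * cos (2 * pi * (z.1 * z.2)))).
apply: measurable_funM; first exact: measurableT_comp.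
by apply: (measurableT_comp measurable_cos); exact: measurable_phase.
Qed.

Lemma measurable_sinint p : measurable_fun [set: R] p ->
  measurable_fun [set: R] (sinint p).
Proof.
move=> mp.
apply: (measurable_Rintegral_param
  (F := fun z => p z.2 * sin (2 * pi * (z.1 * z.2)))).
apply: measurable_funM; first exact: measurableT_comp.
by apply: (measurableT_comp measurable_sin); exact: measurable_phase.
Qed.

Section spectral_energy.
Variables (p : R -> R) (ip : mu.-integrable [set: R] (EFin \o p)).

Let mp : measurable_fun [set: R] p.
Proof. by have /measurable_EFinP := measurable_int mu ip. Qed.

(** The real part of e^(2 i pi xi s) phat(xi). Integrated against p(s) it gives |phat(xi)|^2, which
    turns a square of integrals into an iterated integral. *)
Let G (xi s : R) : R :=
  cos (2 * pi * (xi * s)) * cosint p xi + sin (2 * pi * (xi * s)) * sinint p xi.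

Let GE xi s : G xi s = \int[mu]_t (p t * cos (2 * pi * (xi * (t - s)))).
Proof.
have ic : mu.-integrable [set: R] (fun t => (p t * cos (2 * pi * (xi * t)))%:E).
  exact: integrable_mul_cos.
have iS : mu.-integrable [set: R] (fun t => (p t * sin (2 * pi * (xi * t)))%:E).
  exact: integrable_mul_sin.
rewrite /G -!RintegralZl// -RintegralD//; last 2 first.
- exact: (integrableZl measurableT _ ic).
- exact: (integrableZl measurableT _ iS).
by apply: eq_Rintegral => t _; rewrite !mulrBr cosB; ring.
Qed.

Let L1p := \int[mu]_t `|p t|.

Let G_le xi s : `|G xi s| <= L1p.
Proof.
have mphase : measurable_fun [set: R] (fun t => 2 * pi * (xi * (t - s))).
  by apply: measurable_phase; [exact: measurable_cst|exact: measurable_funB].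
rewrite GE (le_trans (le_normr_Rintegral _ _))//.
  exact: integrable_mul_cos.
apply: le_Rintegral => //.
- exact: integrable_norm (integrable_mul_cos ip mphase).
- exact: integrable_norm ip.
- by move=> t _; rewrite normrM ler_piMr// ler_norml cos_geN1 cos_le1.
Qed.

Let measurable_G : measurable_fun [set: R * R] (fun z => G z.1 z.2).
Proof.
apply: measurable_funD; apply: measurable_funM.
- by apply: (measurableT_comp measurable_cos); exact: measurable_phase.
- by apply: (measurableT_comp (measurable_cosint mp)).
- by apply: (measurableT_comp measurable_sin); exact: measurable_phase.
- by apply: (measurableT_comp (measurable_sinint mp)).
Qed.

Let sqE xi : cosint p xi ^+ 2 + sinint p xi ^+ 2 = \int[mu]_s (p s * G xi s).
Proof.
have ic : mu.-integrable [set: R] (fun t => (p t * cos (2 * pi * (xi * t)))%:E).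
  exact: integrable_mul_cos.
have iS : mu.-integrable [set: R] (fun t => (p t * sin (2 * pi * (xi * t)))%:E).
  exact: integrable_mul_sin.
rewrite !expr2 {1}/cosint {1}/sinint -!RintegralZr// -RintegralD//; last 2 first.
- exact: (integrableZr measurableT _ ic).
- exact: (integrableZr measurableT _ iS).
by apply: eq_Rintegral => t _; rewrite /G; ring.
Qed.

Variables (c : R) (c0 : 0 < c).
Let k (xi : R) := expR (- (c * `|xi|)).

Let mk : measurable_fun [set: R] k.
Proof. by apply: continuous_measurable_fun; exact: continuous_expRN_norm. Qed.

Let ik : mu.-integrable [set: R] (EFin \o k).
Proof. exact: integrable_expRN_norm. Qed.

(** Integrating in xi first evaluates the transform of the damping factor at t - s. The exchange is
    legitimate because the integrand is dominated by k(xi) |p(t)|, where [k] is integrable. *)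
Lemma Rintegral_k_G s : \int[mu]_xi (k xi * G xi s) =
  \int[mu]_t (p t * poisson c (t - s)).
Proof.
have mF : measurable_fun [set: R * R]
    (fun z => k z.1 * (p z.2 * cos (2 * pi * (z.1 * (z.2 - s))))).
  apply: measurable_funM; first exact: measurableT_comp.
  apply: measurable_funM; first exact: measurableT_comp.
  apply: (measurableT_comp measurable_cos); apply: measurable_phase => //.
  exact: measurable_funB.
under eq_Rintegral => xi _.
  rewrite GE -RintegralZl//; last first.
    apply: integrable_mul_cos => //; apply: measurable_phase.
      exact: measurable_cst.
    exact: measurable_funB.
  over.
rewrite (Rintegral_fubini mF ik (integrable_norm ip)); last first.
  move=> xi t; rewrite /= !normrM ger0_norm ?expR_ge0// ler_wpM2l ?expR_ge0//.
  by rewrite ler_piMr// ler_norml cos_geN1 cos_le1.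
apply: eq_Rintegral => t _ /=.
under eq_Rintegral do rewrite mulrCA.
rewrite RintegralZl//; last first.
  by apply: integrable_mul_cos => //; apply: measurable_phase.
congr (_ * _); rewrite /Rintegral.
under eq_integral do rewrite mulrA.
by rewrite integral_expRN_norm_poisson.
Qed.

Let dom2 : forall xi s, `|k xi * (p s * G xi s)| <= (k xi * L1p) * `|p s|.
Proof.
move=> xi s; rewrite !normrM ger0_norm ?expR_ge0// -mulrA ler_wpM2l ?expR_ge0//.
by rewrite mulrC ler_wpM2r.
Qed.

Let mF2 : measurable_fun [set: R * R] (fun z => k z.1 * (p z.2 * G z.1 z.2)).
Proof.
apply: measurable_funM; first exact: measurableT_comp.
by apply: measurable_funM => //; exact: measurableT_comp.
Qed.

Let ikL : mu.-integrable [set: R] (EFin \o (fun xi => k xi * L1p)).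
Proof.
have := integrableZr measurableT L1p ik.
by congr (_.-integrable _ _); apply/funext.
Qed.

Let kinner xi : k xi * (cosint p xi ^+ 2 + sinint p xi ^+ 2) =
  \int[mu]_s (k xi * (p s * G xi s)).
Proof.
rewrite sqE RintegralZl//.
have /(_ xi) := integrable_section1 mF2 (integrable_norm ip) dom2.
have k0 : k xi != 0 by rewrite gt_eqF ?expR_gt0.
(* The section bound yields integrability of the product with [k xi]; dividing by this positive
   number gives that of [p s * G xi s]. *)
move=> /(integrableZl measurableT (k xi)^-1).
by congr (_.-integrable _ _); apply/funext => s; rewrite /= -EFinM mulKf.
Qed.

(** The triple integral over xi, s and t is treated as two double ones. While xi and s are
    exchanged, the integral in t stays hidden in [G], which is bounded by the L1 norm of p;
    [Rintegral_k_G] then exchanges xi and t. *)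
Lemma integral_spectral_energy :
  (\int[mu]_xi (k xi * (cosint p xi ^+ 2 + sinint p xi ^+ 2))%:E =
   (\int[mu]_s (p s * \int[mu]_t (p t * poisson c (t - s))))%:E)%E.
Proof.
have := integrable_Rintegral_param mF2 ikL (integrable_norm ip) dom2.
move=> /(integrable_fin_num measurableT)/fineK H.
under eq_integral do rewrite kinner.
rewrite -H; congr EFin; rewrite -/(Rintegral _ _ _).
rewrite (Rintegral_fubini mF2 ikL (integrable_norm ip) dom2).
apply: eq_Rintegral => s _ /=; rewrite -Rintegral_k_G.
under [LHS]eq_Rintegral do rewrite mulrCA.
rewrite RintegralZl//.
have ikL' : mu.-integrable [set: R] (fun xi => (L1p * k xi)%:E).
  by move: ikL; congr (_.-integrable _ _); apply/funext => x /=; rewrite mulrC.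
apply: le_integrable ikL' => //.
  apply/measurable_EFinP; apply: measurable_funM => //.
  exact: (measurableT_comp measurable_G (measurable_pair2 s)).
move=> xi _; rewrite /= lee_fin normrM mulrC [X in _ <= X]normrM.
by rewrite ler_wpM2r// (le_trans (G_le _ _))// ler_norm.
Qed.

End spectral_energy.
End real_fourier.

(** * Bessel's inequality, and Plancherel for bounded, almost everywhere continuous functions *)

Section plancherel_nice.
Context {R : realType}.
Local Notation mu := (@lebesgue_measure R).
Implicit Types p : R -> R.

Lemma measurable_energy p : measurable_fun [set: R] p ->
  measurable_fun [set: R] (fun xi => cosint p xi ^+ 2 + sinint p xi ^+ 2).
Proof.
move=> mp; apply: measurable_funD; apply: measurable_funX.
  exact: measurable_cosint.
exact: measurable_sinint.
Qed.

Lemma measurable_poisson2 (c : R) : 0 < c ->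
  measurable_fun [set: R * R] (fun z => poisson c (z.2 - z.1)).
Proof.
move=> c0; apply: (measurableT_comp (measurable_poisson c0)).
exact: measurable_funB.
Qed.

Lemma integrable_mul_bounded p (g : R -> R) (M : R) :
  mu.-integrable [set: R] (EFin \o p) -> measurable_fun [set: R] g ->
  (forall t, `|g t| <= M) ->
  mu.-integrable [set: R] (fun t => (p t * g t)%:E).
Proof.
move=> ip mg gM; have /measurable_EFinP mp := measurable_int mu ip.
apply: le_integrable (integrableZl measurableT M ip) => //.
  by apply/measurable_EFinP; exact: measurable_funM.
move=> t _; rewrite /= lee_fin !normrM mulrC ler_wpM2r// (le_trans (gM t))//.
exact: ler_norm.
Qed.

Lemma poisson_le (c x : R) : 0 < c -> `|poisson c x| <= 2 / c.
Proof.
move=> c0; rewrite ger0_norm ?poisson_ge0// /poisson.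
rewrite ler_pdivrMr ?ltr_pwDl ?exprn_gt0 ?sqr_ge0//.
have -> : 2 * c = 2 / c * c ^+ 2 by field; rewrite gt_eqF.
by rewrite ler_wpM2l ?lerDl ?sqr_ge0// divr_ge0// ltW.
Qed.

Lemma integral_sqr_poisson1 p (c : R) : measurable_fun [set: R] p -> 0 < c ->
  (\int[mu]_s \int[mu]_t (p s ^+ 2 * poisson c (t - s))%:E =
   \int[mu]_s (p s ^+ 2)%:E)%E.
Proof.
move=> mp c0; apply: eq_integral => s _.
under eq_integral do rewrite EFinM.
rewrite ge0_integralZl_EFin ?sqr_ge0//.
- by rewrite integral_poisson_shift// mule1.
- by move=> t _; rewrite lee_fin poisson_ge0.
- apply/measurable_EFinP; apply: (measurableT_comp (measurable_poisson c0)).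
  exact: measurable_funB.
Qed.

Lemma bessel_damped p (c : R) : mu.-integrable [set: R] (EFin \o p) -> 0 < c ->
  (\int[mu]_xi (expR (- (c * `|xi|)) * (cosint p xi ^+ 2 + sinint p xi ^+ 2))%:E
   <= \int[mu]_t (p t ^+ 2)%:E)%E.
Proof.
move=> ip c0; have /measurable_EFinP mp := measurable_int mu ip.
rewrite integral_spectral_energy//.
set h := fun s => p s * _.
have mP2 := measurable_poisson2 c0.
have mP s : measurable_fun [set: R] (fun t => poisson c (t - s)).
  exact: (measurableT_comp mP2 (measurable_pair1 s)).
have m1 : measurable_fun [set: R * R] (fun z => p z.1 ^+ 2 * poisson c (z.2 - z.1)).
  by apply: measurable_funM => //; apply: measurable_funX; exact: measurableT_comp.
have m2 : measurable_fun [set: R * R] (fun z => p z.2 ^+ 2 * poisson c (z.2 - z.1)).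
  by apply: measurable_funM => //; apply: measurable_funX; exact: measurableT_comp.
have mh : measurable_fun [set: R] h.
  apply: measurable_funM => //.
  apply: (measurable_Rintegral_param (F := fun z => p z.2 * poisson c (z.2 - z.1))).
  by apply: measurable_funM => //; exact: measurableT_comp.
have ge0 (x y : R) : (0 <= (p x ^+ 2 * poisson c y)%:E)%E.
  by rewrite lee_fin mulr_ge0 ?sqr_ge0 ?poisson_ge0.
pose A s t := (p s ^+ 2 * poisson c (t - s))%:E.
pose B s t := (p t ^+ 2 * poisson c (t - s))%:E.
have mA s : measurable_fun [set: R] (A s).
  apply/measurable_EFinP; exact: (measurableT_comp m1 (measurable_pair1 s)).
have mB s : measurable_fun [set: R] (B s).
  apply/measurable_EFinP; exact: (measurableT_comp m2 (measurable_pair1 s)).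
have IA : (\int[mu]_s \int[mu]_t A s t = \int[mu]_t (p t ^+ 2)%:E)%E.
  exact: integral_sqr_poisson1.
have IB : (\int[mu]_s \int[mu]_t B s t = \int[mu]_t (p t ^+ 2)%:E)%E.
  (* Tonelli and the symmetry of the kernel in s and t carry the p(t)^2 term to the p(s)^2 term. *)
  rewrite -(integral_sqr_poisson1 mp c0).
  transitivity (\int[mu]_t \int[mu]_s B s t)%E.
    apply: (@fubini_tonelli _ _ _ _ _ mu mu (fun z => B z.1 z.2)).
      exact/measurable_EFinP.
    by move=> z; exact: ge0.
  apply: eq_integral => t _; apply: eq_integral => s _.
  by rewrite /B poissonB.
have mIA : measurable_fun [set: R] (fun s => \int[mu]_t A s t)%E.
  apply: (ge0_measurable_integral_param (F := fun z => A z.1 z.2)).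
    exact/measurable_EFinP.
  by move=> z; exact: ge0.
have mIB : measurable_fun [set: R] (fun s => \int[mu]_t B s t)%E.
  apply: (ge0_measurable_integral_param (F := fun z => B z.1 z.2)).
    exact/measurable_EFinP.
  by move=> z; exact: ge0.
have IA0 s : (0 <= \int[mu]_t A s t)%E by apply: integral_ge0 => t _; exact: ge0.
have IB0 s : (0 <= \int[mu]_t B s t)%E by apply: integral_ge0 => t _; exact: ge0.
have half : (\int[mu]_s (2^-1%:E * (\int[mu]_t A s t + \int[mu]_t B s t)) =
    \int[mu]_t (p t ^+ 2)%:E)%E.
  rewrite ge0_integralZl_EFin//; last 2 first.
  - by move=> s _; exact: adde_ge0.
  - exact: emeasurable_funD.
  rewrite ge0_integralD// IA IB -[X in (X + _)%E]mul1e -[X in (_ + X)%E]mul1e.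
  rewrite -ge0_muleDl// muleA (_ : (2^-1%:E * (1 + 1) = 1)%E) ?mul1e//.
  by rewrite -EFinD -EFinM; congr EFin; field.
rewrite -half.
have ipP s : mu.-integrable [set: R] (fun t => (p t * poisson c (t - s))%:E).
  apply: (@integrable_mul_bounded _ _ (2 / c)) => // t; exact: poisson_le.
apply: (@le_trans _ _ (\int[mu]_s `|(h s)%:E|)%E).
  (* If the integral of [h] is infinite, its real value is 0 by convention, and the bound by the
     integral of |h| still holds. *)
  rewrite /Rintegral; have [ifin|] := boolP ((\int[mu]_s (h s)%:E)%E \is a fin_num).
    rewrite fineK// (le_trans (lee_abs _))//; apply: le_abse_integral => //.
    exact/measurable_EFinP.
  rewrite fin_numEn => /orP[] /eqP ->; exact: integral_ge0.
apply: ge0_le_integral => //.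
- by apply: measurableT_comp => //; exact/measurable_EFinP.
- by apply: emeasurable_funM => //; exact: emeasurable_funD.
move=> s _.
have A0 t : [set: R] t -> (0 <= A s t)%E by move=> _; exact: ge0.
have B0 t : [set: R] t -> (0 <= B s t)%E by move=> _; exact: ge0.
rewrite -(ge0_integralD mu measurableT A0 (mA s) B0 (mB s)).
have mAB : measurable_fun [set: R] (fun t => A s t + B s t)%E.
  exact: emeasurable_funD (mA s) (mB s).
have AB0 t : [set: R] t -> (0 <= A s t + B s t)%E.
  by move=> _; rewrite adde_ge0 ?A0 ?B0.
rewrite -(ge0_integralZl_EFin mu measurableT AB0 mAB)//.
have mpP : measurable_fun [set: R] (fun t => (p t * poisson c (t - s))%:E).
  exact: measurable_int (ipP s).
rewrite /h EFinM abseM [X in (_ * X)%E](EFin_normr_Rintegral measurableT (ipP s)).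
apply: (@le_trans _ _ (`|(p s)%:E| * \int[mu]_t `|(p t * poisson c (t - s))%:E|)%E).
  by apply: lee_wpmul2l => //; exact: le_abse_integral.
rewrite -ge0_integralZl//; last exact: measurableT_comp.
apply: ge0_le_integral => //.
- by apply: emeasurable_funM => //; exact: measurableT_comp.
- by apply: emeasurable_funM => //; exact: emeasurable_funD.
move=> t _; rewrite -EFinM -EFinD -EFinM lee_fin.
rewrite normrM (ger0_norm (poisson_ge0 _ c0)) mulrA -mulrDl mulrA.
rewrite ler_wpM2r ?poisson_ge0//.
have := sqr_ge0 (`|p s| - `|p t|).
rewrite sqrrB !real_normK ?num_real//; lra.
Qed.

(** With c = 1 / (n + 1) the damping factors increase to 1, and monotone convergence covers also the
    case of an infinite energy. *)
Lemma cvg_energy_damped p : measurable_fun [set: R] p ->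
  (\int[mu]_xi (expR (- (n.+1%:R^-1 * `|xi|)) *
      (cosint p xi ^+ 2 + sinint p xi ^+ 2))%:E)%E @[n --> \oo] -->
  (\int[mu]_xi (cosint p xi ^+ 2 + sinint p xi ^+ 2)%:E)%E.
Proof.
move=> mp; have mE := measurable_energy mp.
pose f (n : nat) xi := (expR (- (n.+1%:R^-1 * `|xi|)) *
  (cosint p xi ^+ 2 + sinint p xi ^+ 2))%:E.
have -> : (\int[mu]_xi (cosint p xi ^+ 2 + sinint p xi ^+ 2)%:E)%E =
    (\int[mu]_xi (fun x => limn (f ^~ x)) xi)%E.
  apply: eq_integral => xi _; apply/esym/cvg_lim => //.
  apply: cvg_EFin; first exact: nearW.
  rewrite -[X in _ --> X]mul1r; apply: cvgM; last exact: cvg_cst.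
  rewrite -[X in _ --> X](@expR0 R).
  have e : - (n.+1%:R^-1 * `|xi|) @[n --> \oo] --> (0 : R).
    rewrite -[X in _ --> X]oppr0 -[X in _ --> - X](mul0r `|xi|).
    by apply: cvgN; apply: cvgM; [exact: cvg_harmonic|exact: cvg_cst].
  by apply: continuous_cvg; [exact: continuous_expR|exact: e].
apply: cvg_monotone_convergence => //.
- move=> n; apply/measurable_EFinP; apply: measurable_funM => //.
  by apply: continuous_measurable_fun; exact: continuous_expRN_norm.
- by move=> n xi _; rewrite lee_fin mulr_ge0 ?expR_ge0// addr_ge0 ?sqr_ge0.
- move=> xi _ m n mn; rewrite lee_fin ler_wpM2r ?addr_ge0 ?sqr_ge0//.
  rewrite ler_expR lerN2 ler_wpM2r// lef_pV2 ?posrE// ler_nat ltnS.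
  done.
Qed.

Lemma bessel p : mu.-integrable [set: R] (EFin \o p) ->
  (\int[mu]_xi (cosint p xi ^+ 2 + sinint p xi ^+ 2)%:E
   <= \int[mu]_t (p t ^+ 2)%:E)%E.
Proof.
move=> ip; have /measurable_EFinP mp := measurable_int mu ip.
have h := cvg_energy_damped mp.
rewrite -(cvg_lim _ h)//; apply: lime_le.
  by apply/cvg_ex; eexists; exact: h.
by apply: nearW => n; exact: bessel_damped.
Qed.

Section bounded_ae_continuous.
Variables (p : R -> R) (M : R).
Hypotheses (ip : mu.-integrable [set: R] (EFin \o p))
  (pM : forall t, `|p t| <= M)
  (cp : {ae mu, forall s, {for s, continuous p}}).

Let mp : measurable_fun [set: R] p.
Proof. by have /measurable_EFinP := measurable_int mu ip. Qed.

(** The rescaling moves c from the kernel into the argument of p. The density is then fixed, and for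
    bounded p a multiple of it dominates the integrands for all c at once. *)
Lemma poisson_smoothingE (c s : R) : 0 < c ->
  \int[mu]_t (p t * poisson c (t - s)) =
  \int[mu]_y (p (c / (2 * pi) * y + s) * cauchy_density y).
Proof.
move=> c0.
have c1 : 0 < c / (2 * pi) by rewrite divr_gt0// mulr_gt0// pi_gt0.
have i1 : mu.-integrable [set: R] (fun t => (p t * poisson c (t - s))%:E).
  apply: (@integrable_mul_bounded _ _ (2 / c)) => //.
    apply: (measurableT_comp (measurable_poisson c0)); exact: measurable_funB.
  by move=> t; exact: poisson_le.
rewrite /Rintegral (integral_affine s c1 i1) -integralZl//; last first.
  exact: (integrable_affine s c1 i1).
congr fine; apply: eq_integral => y _.
rewrite addrK poisson_scale// -EFinM; congr EFin.
have : pi != 0 :> R by rewrite gt_eqF// pi_gt0.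
by move: pi => q q0; field; rewrite q0 gt_eqF.
Qed.

Let inner (n : nat) s :=
  \int[mu]_y (p (n.+1%:R^-1 / (2 * pi) * y + s) * cauchy_density y).

Let inner_dom n s y :
  `|p (n.+1%:R^-1 / (2 * pi) * y + s) * cauchy_density y| <=
  M * cauchy_density y.
Proof.
by rewrite normrM (ger0_norm (cauchy_density_ge0 _)) ler_wpM2r ?cauchy_density_ge0.
Qed.

Let measurable_dens : measurable_fun [set: R] (@cauchy_density R).
Proof. by apply: continuous_measurable_fun; exact: continuous_cauchy_density. Qed.

Let integrable_dens : mu.-integrable [set: R] (fun y => (cauchy_density y)%:E).
Proof.
apply/integrableP; split; first by apply/measurable_EFinP.
under eq_integral do rewrite gee0_abs ?lee_fin ?cauchy_density_ge0//.
by rewrite integral_cauchy_density ltry.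
Qed.

Let integrable_dom : mu.-integrable [set: R] (fun y => (M * cauchy_density y)%:E).
Proof. exact: (integrableZl measurableT M integrable_dens). Qed.

Let measurable_integrand n : measurable_fun [set: R * R]
  (fun z => p (n.+1%:R^-1 / (2 * pi) * z.2 + z.1) * cauchy_density z.2).
Proof.
apply: measurable_funM; last exact: measurableT_comp.
apply: (measurableT_comp mp); apply: measurable_funD => //.
by apply: measurable_funM.
Qed.

Let measurable_integrand1 n s : measurable_fun [set: R]
  (fun y => p (n.+1%:R^-1 / (2 * pi) * y + s) * cauchy_density y).
Proof. exact: (measurableT_comp (measurable_integrand n) (measurable_pair1 s)). Qed.

Let integrable_integrand n s : mu.-integrable [set: R]
  (fun y => (p (n.+1%:R^-1 / (2 * pi) * y + s) * cauchy_density y)%:E).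
Proof.
apply: le_integrable integrable_dom => //.
  by apply/measurable_EFinP; exact: measurable_integrand1.
by move=> y _; rewrite /= lee_fin (le_trans (inner_dom n s y))// ler_norm.
Qed.

Let measurable_inner n : measurable_fun [set: R] (inner n).
Proof. exact: measurable_Rintegral_param (measurable_integrand n). Qed.

Let inner_le n s : `|inner n s| <= M.
Proof.
rewrite (le_trans (le_normr_Rintegral _ (integrable_integrand n s)))//.
have -> : M = \int[mu]_y (M * cauchy_density y).
  rewrite RintegralZl// /Rintegral integral_cauchy_density mulr1//.
apply: le_Rintegral => //; first exact: integrable_norm (integrable_integrand n s).
Qed.

Let cvg_inner s : {for s, continuous p} -> inner n s @[n --> \oo] --> p s.
Proof.
move=> cps.
have : (\int[mu]_y (p (n.+1%:R^-1 / (2 * pi) * y + s) * cauchy_density y)%:E)%E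
    @[n --> \oo] --> (\int[mu]_y (p s * cauchy_density y)%:E)%E.
  apply: (@dominated_cvg _ _ _ mu _ measurableT _ _
    (fun y => (M * cauchy_density y)%:E)) => //.
  - by move=> n; apply/measurable_EFinP; exact: measurable_integrand1.
  - move=> y _; apply: cvg_EFin; first exact: nearW.
    apply: cvgM; last exact: cvg_cst.
    have e : n.+1%:R^-1 / (2 * pi) * y + s @[n --> \oo] --> s.
      rewrite -[X in _ --> X]add0r; apply: cvgD; last exact: cvg_cst.
      rewrite -[X in _ --> X](mul0r y); apply: cvgM; last exact: cvg_cst.
      rewrite -[X in _ --> X](mul0r (2 * pi)^-1); apply: cvgM; last exact: cvg_cst.
      exact: cvg_harmonic.
    by apply: continuous_cvg; [exact: cps|exact: e].
  - by move=> n y _; rewrite lee_fin inner_dom.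
have -> : (\int[mu]_y (p s * cauchy_density y)%:E = (p s)%:E)%E.
  under eq_integral do rewrite EFinM.
  by rewrite integralZl// integral_cauchy_density mule1.
by move/fine_cvg.
Qed.

(** The damped energies have two limits, which must agree: the full energy, by monotone convergence,
    and the integral of p^2, by dominated convergence with the integrable bound M |p(s)|. *)
Lemma plancherel_bounded_ae_continuous :
  (\int[mu]_xi (cosint p xi ^+ 2 + sinint p xi ^+ 2)%:E
   = \int[mu]_t (p t ^+ 2)%:E)%E.
Proof.
have M0 : 0 <= M by rewrite (le_trans _ (pM 0)).
have fE n : (\int[mu]_xi (expR (- (n.+1%:R^-1 * `|xi|)) *
      (cosint p xi ^+ 2 + sinint p xi ^+ 2))%:E =
    \int[mu]_s (p s * inner n s)%:E)%E.
  rewrite integral_spectral_energy//.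
  under eq_Rintegral do rewrite poisson_smoothingE//.
  rewrite /Rintegral fineK//; apply: (integrable_fin_num measurableT).
  exact: (integrable_mul_bounded ip (measurable_inner n) (inner_le n)).
have lim1 := cvg_energy_damped mp.
have lim2 : (\int[mu]_s (p s * inner n s)%:E)%E @[n --> \oo] -->
    (\int[mu]_s (p s ^+ 2)%:E)%E.
  have iM : mu.-integrable [set: R] (fun s => (M * `|p s|)%:E).
    exact: (integrableZl measurableT M (integrable_norm ip)).
  have [] := @dominated_convergence _ _ _ mu _ measurableT
    (fun n s => (p s * inner n s)%:E) (fun s => (p s ^+ 2)%:E)
    (fun s => (M * `|p s|)%:E).
  - by move=> n; apply/measurable_EFinP; exact: (measurable_funM mp (measurable_inner n)).
  - by apply/measurable_EFinP; exact: measurable_funX.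
  - have [N [mN N0 Ncp]] := cp; exists N; split => //.
    apply: subset_trans Ncp => s /= + cs; apply => _.
    apply: cvg_EFin; first exact: nearW.
    by rewrite expr2; apply: cvgM; [exact: cvg_cst|exact: cvg_inner].
  - exact: iM.
  - by apply: aeW => s n _; rewrite lee_fin normrM mulrC ler_wpM2r.
  - by [].
rewrite (_ : (fun n => _) = (fun n => \int[mu]_s (p s * inner n s)%:E)%E) in lim1.
  exact: (cvg_unique _ lim1 lim2).
exact/funext.
Qed.

End bounded_ae_continuous.
End plancherel_nice.

(** * Equality of L2 norms under approximation *)

Section L2_approximation.
Context {R : realType}.
Local Notation mu := (@lebesgue_measure R).

Definition sqnorm (f : R -> R[i]) : \bar R := (\int[mu]_t (cmod (f t) ^+ 2)%:E)%E.

Lemma cmod_sqE (z : R[i]) :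
  cmod z ^+ 2 = complex.Re z ^+ 2 + complex.Im z ^+ 2.
Proof.
by case: z => a b; rewrite /cmod /= sqr_sqrtr// addr_ge0 ?sqr_ge0.
Qed.

Lemma measurable_cmod_sq (f : R -> R[i]) : cmeasurable f ->
  measurable_fun [set: R] (fun t => (cmod (f t) ^+ 2)%:E).
Proof.
move=> [mr mi]; apply/measurable_EFinP; under eq_fun do rewrite cmod_sqE.
by apply: measurable_funD; exact: measurable_funX.
Qed.

Lemma cmeasurableB (f g : R -> R[i]) : cmeasurable f -> cmeasurable g ->
  cmeasurable (fun t => f t - g t).
Proof.
move=> [fr fi] [gr gi]; split.
  rewrite (_ : (fun _ => _) = (fun t => complex.Re (f t) - complex.Re (g t))).
    exact: measurable_funB.
  by apply/funext => t; case: (f t) (g t) => [? ?] [].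
rewrite (_ : (fun _ => _) = (fun t => complex.Im (f t) - complex.Im (g t))).
  exact: measurable_funB.
by apply/funext => t; case: (f t) (g t) => [? ?] [].
Qed.

Lemma cmod_sq_ge0 (z : R[i]) : (0 <= (cmod z ^+ 2)%:E)%E.
Proof. by rewrite lee_fin sqr_ge0. Qed.

(** A quadratic triangle inequality, which can be integrated as it stands; the factor in front of
    |y|^2 can be taken as close to 1 as desired. *)
Lemma cmod_sq_young (e : R) (x y : R[i]) : 0 < e ->
  cmod x ^+ 2 <= (1 + e) * cmod y ^+ 2 + (1 + e^-1) * cmod (x - y) ^+ 2.
Proof.
move=> e0.
have young (a b : R) : a ^+ 2 <= (1 + e) * b ^+ 2 + (1 + e^-1) * (a - b) ^+ 2.
  rewrite -subr_ge0.
  rewrite (_ : _ - _ = e^-1 * (e * b - (a - b)) ^+ 2); last first.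
    by field; rewrite gt_eqF.
  by rewrite mulr_ge0 ?sqr_ge0// invr_ge0 ltW.
case: x y => [x1 x2] [y1 y2]; rewrite !cmod_sqE /= !mulrDr.
have := young x1 y1; have := young x2 y2; lra.
Qed.

Lemma sqnorm_young (e : R) (f g : R -> R[i]) : 0 < e ->
  cmeasurable f -> cmeasurable g ->
  (sqnorm f <= (1 + e)%:E * sqnorm g
    + (1 + e^-1)%:E * sqnorm (fun t => f t - g t)%R)%E.
Proof.
move=> e0 mf mg; have mfg := cmeasurableB mf mg.
have e1 : 0 <= 1 + e by rewrite addr_ge0// ltW.
have e2 : 0 <= 1 + e^-1 by rewrite addr_ge0// invr_ge0 ltW.
have M1 := measurable_cmod_sq mf.
have M2 := measurable_cmod_sq mg.
have M3 := measurable_cmod_sq mfg.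
have M2' : measurable_fun [set: R] (fun t => (1 + e)%:E * (cmod (g t) ^+ 2)%:E)%E.
  exact: emeasurable_funM.
have M3' : measurable_fun [set: R]
    (fun t => (1 + e^-1)%:E * (cmod (f t - g t) ^+ 2)%:E)%E.
  exact: emeasurable_funM.
have nneg k (h : R -> R[i]) t : 0 <= k -> (0 <= k%:E * (cmod (h t) ^+ 2)%:E)%E.
  by move=> k0; rewrite mule_ge0 ?cmod_sq_ge0.
rewrite /sqnorm -!ge0_integralZl_EFin//; [|by move=> t _; exact: cmod_sq_ge0..].
have G0 t : [set: R] t -> (0 <= (1 + e)%:E * (cmod (g t) ^+ 2)%:E)%E.
  by move=> _; exact: nneg.
have D0 t : [set: R] t -> (0 <= (1 + e^-1)%:E * (cmod (f t - g t) ^+ 2)%:E)%E.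
  by move=> _; exact: (nneg _ (fun t => f t - g t)).
rewrite -(ge0_integralD mu measurableT G0 M2' D0 M3').
apply: ge0_le_integral => //.
- by move=> t _; exact: cmod_sq_ge0.
- exact: emeasurable_funD.
- by move=> t _; rewrite -!EFinM -EFinD lee_fin cmod_sq_young.
Qed.

(** Young's inequality compares f with a and b with g; the equality of the norms of a and b links
    the two estimates. *)
Lemma le_sqnorm_approx (f g : R -> R[i]) : cmeasurable f -> cmeasurable g ->
  (forall e : R, 0 < e -> exists a b : R -> R[i],
    [/\ cmeasurable a, cmeasurable b,
        (sqnorm (fun t => f t - a t)%R <= e%:E)%E,
        (sqnorm (fun t => b t - g t)%R <= e%:E)%E & sqnorm a = sqnorm b]) ->
  (sqnorm f <= sqnorm g)%E.
Proof.
move=> mf mg H.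
have [|] := boolP (sqnorm g == +oo%E); first by move=> /eqP ->; rewrite leey.
move=> gfin.
have g0 : (0 <= sqnorm g)%E by apply: integral_ge0 => t _; exact: cmod_sq_ge0.
have {gfin} : sqnorm g \is a fin_num by rewrite ge0_fin_numE// ltey.
move=> /fineK gE; rewrite -gE in g0 *; move: (fine _) g0 gE => G.
rewrite lee_fin => G0 gE.
apply/lee_addgt0Pr => d d0.
(* The two estimates will combine to (1 + h) ((1 + h) G + 2 h) + 2 h = G + h (2 G + h G + 4 + 2 h),
   which is at most G + h (3 G + 6) for h <= 1. *)
have [h [h0 h1 hd]] : exists h, [/\ 0 < h, h <= 1 & h * (3 * G + 6) <= d].
  have G6 : 0 < 3 * G + 6 by rewrite ltr_wpDl// mulr_ge0.
  exists (Num.min 1 (d / (3 * G + 6))); split.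
  - by rewrite lt_min ltr01 divr_gt0.
  - by rewrite ge_min lexx.
  - by rewrite -ler_pdivlMr// ge_min lexx orbT.
(* With error h^2 the Young factor 1 + 1/h contributes only h + h^2. *)
have [a [b [ma mb fa bg ab]]] := H (h ^+ 2) (exprn_gt0 2 h0).
have hh : (1 + h^-1) * h ^+ 2 <= 2 * h.
  have -> : (1 + h^-1) * h ^+ 2 = h ^+ 2 + h by field; rewrite gt_eqF.
  nra.
have hV : 0 <= 1 + h^-1 by rewrite addr_ge0// invr_ge0 ltW.
have bG : (sqnorm b <= ((1 + h) * G + 2 * h)%:E)%E.
  rewrite (le_trans (sqnorm_young h0 mb mg))// -gE [leRHS]EFinD [in leRHS]EFinM.
  apply: leeD => //; apply: (@le_trans _ _ ((1 + h^-1)%:E * (h ^+ 2)%:E)%E).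
    by apply: lee_wpmul2l => //; rewrite lee_fin.
  by rewrite -EFinM lee_fin.
rewrite (le_trans (sqnorm_young h0 mf ma))// ab.
apply: (@le_trans _ _ ((1 + h)%:E * ((1 + h) * G + 2 * h)%:E + (2 * h)%:E)%E).
  apply: leeD; first by rewrite lee_wpmul2l// lee_fin addr_ge0// ltW.
  apply: (@le_trans _ _ ((1 + h^-1)%:E * (h ^+ 2)%:E)%E).
    by apply: lee_wpmul2l => //; rewrite lee_fin.
  by rewrite -EFinM lee_fin.
rewrite -EFinM -!EFinD lee_fin.
have hG : h * h * G <= h * G by rewrite ler_wpM2r// ler_piMl// ltW.
nra.
Qed.

Lemma cmodBC (x y : R[i]) : cmod (x - y) = cmod (y - x).
Proof. by rewrite -opprB; case: (y - x) => a b; rewrite /cmod/= !sqrrN. Qed.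

(** This is how each isometry is extended: from the dense class to real functions in L1 and L2, and
    from there to the L2 transform, also after adding a translate. *)
Lemma eq_sqnorm_approx (f g : R -> R[i]) : cmeasurable f -> cmeasurable g ->
  (forall e : R, 0 < e -> exists a b : R -> R[i],
    [/\ cmeasurable a, cmeasurable b,
        (sqnorm (fun t => a t - f t)%R <= e%:E)%E,
        (sqnorm (fun t => b t - g t)%R <= e%:E)%E & sqnorm a = sqnorm b]) ->
  sqnorm f = sqnorm g.
Proof.
have sqnormBC (u v : R -> R[i]) :
    sqnorm (fun t => u t - v t) = sqnorm (fun t => v t - u t).
  by apply: eq_integral => t _; rewrite cmodBC.
move=> mf mg H; apply/eqP; rewrite eq_le; apply/andP; split.
  apply: le_sqnorm_approx => // e /H[a [b [ma mb fa gb ab]]].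
  by exists a, b; split => //; rewrite sqnormBC.
apply: le_sqnorm_approx => // e /H[a [b [ma mb fa gb ab]]].
by exists b, a; split => //; rewrite sqnormBC.
Qed.

End L2_approximation.

Lemma cvge0_near_le (R : realType) (u : nat -> \bar R) (e : R) : 0 < e ->
  u @ \oo --> 0%E -> \forall n \near \oo, (u n <= e%:E)%E.
Proof.
move=> e0 u0.
have /u0 ue : nbhs (0%E : \bar R) [set x | (x < e%:E)%E].
  by apply: open_ereal_lt'; rewrite lte_fin.
near=> n; apply: ltW; near: n; exact: ue.
Unshelve. all: by end_near. Qed.

(** * Density of bounded, almost everywhere continuous integrable functions *)

Section density.
Context {R : realType}.
Local Notation mu := (@lebesgue_measure R).
Variables (p : R -> R) (mp : measurable_fun [set: R] p)
  (p2 : (\int[mu]_t (p t ^+ 2)%:E < +oo)%E).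

Let trunc (n : nat) (t : R) : R :=
  if (`|t| <= n%:R) && (`|p t| <= n%:R) then p t else 0.

Let measurable_trunc n : measurable_fun [set: R] (trunc n).
Proof.
apply: measurable_fun_ifT => //; apply: measurable_and.
  by apply: measurable_fun_ler => //; exact: measurableT_comp.
by apply: measurable_fun_ler => //; exact: measurableT_comp.
Qed.

Let cvg_trunc : (\int[mu]_t ((p t - trunc n t) ^+ 2)%:E)%E @[n --> \oo] --> 0%E.
Proof.
rewrite -(integral0 mu [set: R]).
apply: (@dominated_cvg _ _ _ mu _ measurableT _ _ (fun t => (p t ^+ 2)%:E)) => //.
- move=> n; apply/measurable_EFinP; apply: measurable_funX.
  exact: (measurable_funB mp (measurable_trunc n)).
- move=> t _; apply: cvg_near_cst.
  near=> n; rewrite /trunc ifT ?subrr ?expr0n//.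
  apply/andP; split; near: n; exact: nbhs_infty_ger.
- apply/integrableP; split; first by apply/measurable_EFinP; exact: measurable_funX.
  by under eq_integral do rewrite gee0_abs ?lee_fin ?sqr_ge0//.
- move=> n t _; rewrite lee_fin ger0_norm ?sqr_ge0// /trunc.
  by case: ifPn => _; rewrite ?subr0// subrr expr0n sqr_ge0.
Unshelve. all: by end_near. Qed.

Let trunc_le n t : `|trunc n t| <= n%:R.
Proof. by rewrite /trunc; case: ifPn => [/andP[]//|_]; rewrite normr0. Qed.

(** The truncation of p lives on [-n, n], where continuous functions approximate it in L1. Clipping
    such a function to the values [-n, n] makes the L1 error control the L2 error, and cutting it
    off outside the interval makes it integrable on the line. *)
Lemma bounded_ae_continuous_dense (e : R) : 0 < e ->
  exists (r : R -> R) (M : R),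
    [/\ mu.-integrable [set: R] (EFin \o r), forall t, `|r t| <= M,
        {ae mu, forall s, {for s, continuous r}} &
        (\int[mu]_t ((r t - p t) ^+ 2)%:E <= e%:E)%E].
Proof.
move=> e0.
(* The truncation error and the approximation error are each at most e / 4, and both are doubled by
   the inequality [sq] below. *)
have e4 : 0 < e / 4 by rewrite divr_gt0.
have [n Hn] : exists n : nat,
    (\int[mu]_t ((p t - trunc n t) ^+ 2)%:E <= (e / 4)%:E)%E.
  exact: filter_ex (cvge0_near_le e4 cvg_trunc).
pose E : set R := [set` `[- n%:R, n%:R]].
have mE : measurable E by exact: measurable_itv.
have muE : (mu E < +oo)%E.
  by rewrite lebesgue_measure_itv/=; case: ifPn => // _; rewrite -EFinB ltry.
have iq : mu.-integrable E (EFin \o trunc n).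
  apply: measurable_bounded_integrable => //.
    by apply: measurable_funTS; exact: measurable_trunc.
  exists n%:R; split; first exact: num_real.
  by move=> x xn t _ /=; rewrite (le_trans (trunc_le n t))// ltW.
have [g_ [cg_ ig_ g_cvg]] := approximation_continuous_integrable mE muE iq.
(* Two functions bounded by n differ by at most 2 n, so their squared distance is at most 2 (n + 1)
   times their distance; n + 1 instead of n keeps the divisor positive when n = 0. *)
pose d := e / 4 / (2 * n.+1%:R).
have d0 : 0 < d by rewrite divr_gt0.
have [m Hm] : exists m : nat,
    (\int[mu]_(z in E) `|(trunc n z - g_ m z)%:E| <= d%:E)%E.
  exact: filter_ex (cvge0_near_le d0 g_cvg).
pose clip (x : R) : R := Num.max (- n%:R) (Num.min n%:R x).
pose g := clip \o g_ m.
have cg : continuous g.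
  move=> x; apply: continuous_comp; first exact: cg_.
  apply: (@continuous_comp _ _ _ (fun y : R => Num.min n%:R y) (Num.max (- n%:R))).
    by apply: (@continuous_min R R (cst n%:R) id); [exact: cvg_cst|exact: cvg_id].
  by apply: (@continuous_max R R (cst (- n%:R)) id); [exact: cvg_cst|exact: cvg_id].
have clipn x : `|clip x| <= n%:R.
  rewrite ler_norml /clip le_max lexx/= ge_max ge_min lexx andbT.
  by rewrite (le_trans (_ : _ <= 0)) ?oppr_le0.
have gn t : `|g t| <= n%:R by exact: clipn.
(* Clipping is the projection onto [-n, n], so it does not increase the distance to a point of that
   interval. *)
have clip_le x y : `|y| <= n%:R -> `|clip x - y| <= `|y - x|.
  rewrite ler_norml => /andP[ny yn].
  have yx : y - x <= `|y - x| by exact: ler_norm.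
  have xy : x - y <= `|y - x| by rewrite distrC ler_norm.
  rewrite ler_norml /clip /Num.max /Num.min.
  by case: (ltP n%:R x) => xn; case: ltP => xn'; apply/andP; split; lra.
pose r t := if `|t| <= n%:R then g t else 0.
have rn t : `|r t| <= n%:R.
  by rewrite /r; case: ifPn => // _; rewrite normr0.
have mr : measurable_fun [set: R] r.
  apply: measurable_fun_ifT => //; last exact: continuous_measurable_fun.
  by apply: measurable_fun_ler => //; exact: measurableT_comp.
have r_trunc t : (r t - trunc n t) ^+ 2 <=
    2 * n.+1%:R * ((fun z => `|trunc n z - g_ m z|) \_ E) t.
  rewrite /r /patch /E; case: ifPn => tn.
    rewrite ifT; last by rewrite inE/= in_itv/= -ler_norml.
    rewrite -real_normK ?num_real// expr2.
    apply: ler_pM => //; last exact: clip_le (trunc_le n t).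
    rewrite (le_trans (ler_normB _ _))//.
    have := gn t; have := trunc_le n t; rewrite -natr1; lra.
  rewrite ifF; last by apply/negP; rewrite inE/= in_itv/= -ler_norml (negbTE tn).
  by rewrite /trunc (negbTE tn)/= subrr expr0n mulr0.
have rE : r = g \_ E.
  apply/funext => t; rewrite /r /patch /E.
  suff -> : (`|t| <= n%:R) = (t \in ([set` `[- n%:R, n%:R]] : set R)) by [].
  by apply/idP/idP; rewrite inE/= in_itv/= -ler_norml.
exists r, n%:R; split => //.
- have : mu.-integrable E (EFin \o g).
    apply: measurable_bounded_integrable => //.
      by apply: measurable_funTS; exact: continuous_measurable_fun.
    exists n%:R; split; first exact: num_real.
    by move=> x xn t _ /=; rewrite (le_trans (gn t))// ltW.
  move=> ig; have := (@integrable_mkcond _ _ _ mu _ (EFin \o g) mE).1 ig; rewrite rE.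
  by congr (_.-integrable _ _); apply/funext => t; rewrite /= /patch; case: ifPn.
(* Away from the two endpoints [r] coincides locally with the continuous [g] or with 0, so it can be
   discontinuous only on this null set. *)
- exists [set - n%:R; n%:R]; split.
  + exact: measurableU.
  + apply: countable_lebesgue_measure0.
    by apply: finite_set_countable; exact: finite_set2.
  + move=> s /= rs; apply: contrapT => sn; apply: rs.
    have sn' : `|s| != n%:R.
      apply/eqP => sn'; apply: sn; move: sn'.
      have [s0|s0] := leP 0 s.
        by rewrite ger0_norm// => ->; right.
      by rewrite ltr0_norm// => <-; left; rewrite opprK.
    have [lt|gt] : `|s| < n%:R \/ n%:R < `|s|.
      by move: sn'; case: ltgtP => // _ _; [left|right].
    + have near_lt : \forall t \near s, `|t| < n%:R.
        exact: (cvgr_lt `|s| (@norm_continuous _ _ s)).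
      suff : r t @[t --> s] --> r s by [].
      have -> : r s = g s by rewrite /r ltW.
      have := cg s; apply: cvg_trans; apply: near_eq_cvg.
      near=> t; rewrite /r ltW//; near: t; exact: near_lt.
    + have near_gt : \forall t \near s, n%:R < `|t|.
        exact: (cvgr_gt `|s| (@norm_continuous _ _ s)).
      have r0 t : n%:R < `|t| -> r t = 0 by rewrite /r leNgt => ->.
      suff : r t @[t --> s] --> r s by [].
      rewrite (r0 s gt); apply: cvg_near_cst.
      near=> t; apply: r0; near: t; exact: near_gt.
have sq (x y z : R) : (x - z) ^+ 2 <= 2 * (x - y) ^+ 2 + 2 * (z - y) ^+ 2.
  have := sqr_ge0 (x + z - 2 * y); nra.
have m1 : measurable_fun [set: R] (fun t => ((r t - trunc n t) ^+ 2)%:E).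
  apply/measurable_EFinP; apply: measurable_funX.
  exact: (measurable_funB mr (measurable_trunc n)).
have m2 : measurable_fun [set: R] (fun t => ((p t - trunc n t) ^+ 2)%:E).
  apply/measurable_EFinP; apply: measurable_funX.
  exact: (measurable_funB mp (measurable_trunc n)).
have mgE : measurable_fun E (fun z => `|(trunc n z - g_ m z)%:E|%E).
  apply: measurableT_comp => //; apply/measurable_EFinP; apply: measurable_funTS.
  apply: measurable_funB; first exact: measurable_trunc.
  exact: continuous_measurable_fun.
have I2 : (\int[mu]_t ((r t - trunc n t) ^+ 2)%:E <= (e / 4)%:E)%E.
  apply: (@le_trans _ _ ((2 * n.+1%:R)%:E *
      \int[mu]_(z in E) `|(trunc n z - g_ m z)%:E|)%E).
    have -> : (\int[mu]_(z in E) `|(trunc n z - g_ m z)%:E| =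
        \int[mu]_z ((fun z => `|(trunc n z - g_ m z)%:E|%E) \_ E) z)%E.
      exact: integral_mkcond.
    have mgE' : measurable_fun [set: R]
        ((fun z => `|(trunc n z - g_ m z)%:E|%E) \_ E).
      exact/(measurable_restrictT _ mE).
    have gE0 t : (0 <= ((fun z => `|(trunc n z - g_ m z)%:E|%E) \_ E) t)%E.
      by rewrite /patch; case: ifPn.
    rewrite -(ge0_integralZl_EFin mu measurableT (fun t _ => gE0 t) mgE')//.
    apply: ge0_le_integral => //.
    - by move=> t _; rewrite lee_fin sqr_ge0.
    - exact: emeasurable_funM.
    - move=> t _; have := r_trunc t; rewrite -lee_fin => /le_trans; apply.
      by rewrite /patch; case: ifPn => _; rewrite ?mulr0 ?mule0.
  rewrite (le_trans (lee_wpmul2l _ Hm))// -EFinM lee_fin /d.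
  by rewrite mulrC divfK// gt_eqF.
apply: (@le_trans _ _ (2%:E * \int[mu]_t ((r t - trunc n t) ^+ 2)%:E
  + 2%:E * \int[mu]_t ((p t - trunc n t) ^+ 2)%:E)%E).
  have s1 t : [set: R] t -> (0 <= 2%:E * ((r t - trunc n t) ^+ 2)%:E)%E.
    by move=> _; rewrite mule_ge0 ?lee_fin ?sqr_ge0.
  have s2 t : [set: R] t -> (0 <= 2%:E * ((p t - trunc n t) ^+ 2)%:E)%E.
    by move=> _; rewrite mule_ge0 ?lee_fin ?sqr_ge0.
  have s3 (h : R -> R) t : [set: R] t -> (0 <= (h t ^+ 2)%:E)%E.
    by move=> _; rewrite lee_fin sqr_ge0.
  rewrite -(ge0_integralZl_EFin mu measurableT (s3 _) m1)//.
  rewrite -(ge0_integralZl_EFin mu measurableT (s3 _) m2)//.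
  have m1' : measurable_fun [set: R] (fun t => 2%:E * ((r t - trunc n t) ^+ 2)%:E)%E.
    exact: emeasurable_funM.
  have m2' : measurable_fun [set: R] (fun t => 2%:E * ((p t - trunc n t) ^+ 2)%:E)%E.
    exact: emeasurable_funM.
  rewrite -(ge0_integralD mu measurableT s1 m1' s2 m2').
  apply: ge0_le_integral => //.
  - by move=> t _; rewrite lee_fin sqr_ge0.
  - by apply/measurable_EFinP; apply: measurable_funX; exact: measurable_funB.
  - exact: emeasurable_funD.
  - by move=> t _; rewrite -!EFinM -EFinD lee_fin sq.
apply: (@le_trans _ _ (2%:E * (e / 4)%:E + 2%:E * (e / 4)%:E)%E).
  by apply: leeD; rewrite lee_wpmul2l.
by rewrite -!EFinM -EFinD lee_fin; lra.
Unshelve. all: by end_near. Qed.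

End density.

(** * Plancherel's identity on the intersection of L1 and L2 *)

Section plancherel.
Context {R : realType}.
Local Notation mu := (@lebesgue_measure R).

Lemma cosintB (p q : R -> R) (xi : R) : mu.-integrable [set: R] (EFin \o p) ->
  mu.-integrable [set: R] (EFin \o q) ->
  cosint (fun t => p t - q t) xi = cosint p xi - cosint q xi.
Proof.
move=> ip iq; rewrite /cosint -RintegralB//.
- by apply: eq_Rintegral => t _; rewrite mulrBl.
- exact: integrable_mul_cos ip (measurable_phasel xi).
- exact: integrable_mul_cos iq (measurable_phasel xi).
Qed.

Lemma sinintB (p q : R -> R) (xi : R) : mu.-integrable [set: R] (EFin \o p) ->
  mu.-integrable [set: R] (EFin \o q) ->
  sinint (fun t => p t - q t) xi = sinint p xi - sinint q xi.
Proof.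
move=> ip iq; rewrite /sinint -RintegralB//.
- by apply: eq_Rintegral => t _; rewrite mulrBl.
- exact: integrable_mul_sin ip (measurable_phasel xi).
- exact: integrable_mul_sin iq (measurable_phasel xi).
Qed.

Lemma plancherel_real (p : R -> R) : mu.-integrable [set: R] (EFin \o p) ->
  (\int[mu]_t (p t ^+ 2)%:E < +oo)%E ->
  (\int[mu]_xi (cosint p xi ^+ 2 + sinint p xi ^+ 2)%:E =
   \int[mu]_t (p t ^+ 2)%:E)%E.
Proof.
move=> ip p2; have /measurable_EFinP mp := measurable_int mu ip.
have sqC (u : R -> R) : sqnorm (fun t => (u t)%:C) = (\int[mu]_t (u t ^+ 2)%:E)%E.
  by apply: eq_integral => t _; rewrite cmod_sqE/= expr0n addr0.
(* This function is the conjugate of the transform of u, so it has the same modulus. *)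
have sqF (u : R -> R) : sqnorm (fun xi => cosint u xi +i* sinint u xi) =
    (\int[mu]_xi (cosint u xi ^+ 2 + sinint u xi ^+ 2)%:E)%E.
  by apply: eq_integral => t _; rewrite cmod_sqE.
have mC (u : R -> R) : measurable_fun [set: R] u ->
    cmeasurable (fun t => (u t)%:C).
  by move=> mu_; split => //=; exact: measurable_cst.
have mF (u : R -> R) : measurable_fun [set: R] u ->
    cmeasurable (fun xi => cosint u xi +i* sinint u xi).
  by move=> mu_; split => /=; [exact: measurable_cosint|exact: measurable_sinint].
rewrite -sqC -sqF; apply/esym; apply: eq_sqnorm_approx; [exact: mC|exact: mF|].
move=> e e0.
have [r [M [ir rM cr rp]]] := bounded_ae_continuous_dense mp p2 e0.
have /measurable_EFinP mr := measurable_int mu ir.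
have irp : mu.-integrable [set: R] (EFin \o (fun t => r t - p t)).
  exact: (integrableB measurableT ir ip).
exists (fun t => (r t)%:C), (fun xi => cosint r xi +i* sinint r xi).
split; [exact: mC|exact: mF| | |].
- apply: le_trans rp; rewrite -sqC le_eqVlt; apply/orP; left; apply/eqP.
  by apply: eq_integral => t _; rewrite -rmorphB.
- apply: le_trans rp; apply: le_trans (bessel irp); rewrite -sqF.
  rewrite le_eqVlt; apply/orP; left; apply/eqP.
  by apply: eq_integral => xi _; rewrite cosintB// sinintB.
- by rewrite sqC sqF (plancherel_bounded_ae_continuous ir rM cr).
Qed.

Lemma ge0_integral_opp (f : R -> \bar R) : measurable_fun [set: R] f ->
  (forall x, 0 <= f x)%E -> (\int[mu]_x f (- x)%R = \int[mu]_x f x)%E.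
Proof.
move=> mf f0.
have mN : measurable_fun [set: measurableTypeR R]
  (-%R : measurableTypeR R -> measurableTypeR R) by exact: oppr_measurable.
rewrite -[LHS](ge0_integral_pushforward mN mu measurableT mf)//.
by apply: eq_measure_integral => A mA _; exact: lebesgue_measureN.
Qed.

Lemma ge0_integral_symmetrize (G : R -> \bar R) : measurable_fun [set: R] G ->
  (forall x, 0 <= G x)%E ->
  (\int[mu]_x G x = \int[mu]_x (2^-1%:E * G x + 2^-1%:E * G (- x)%R))%E.
Proof.
move=> mG G0.
have mGN : measurable_fun [set: R] (fun x => G (- x)).
  exact: (measurableT_comp mG (@oppr_measurable R setT)).
have h0 (K : R -> \bar R) (K0 : forall x, (0 <= K x)%E) t :
    [set: R] t -> (0 <= 2^-1%:E * K t)%E by move=> _; rewrite mule_ge0.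
have m1 : measurable_fun [set: R] (fun x => 2^-1%:E * G x)%E.
  exact: emeasurable_funM.
have m2 : measurable_fun [set: R] (fun x => 2^-1%:E * G (- x)%R)%E.
  exact: emeasurable_funM.
have GN0 x : (0 <= G (- x)%R)%E by exact: G0.
rewrite (ge0_integralD mu measurableT (h0 _ G0) m1 (h0 _ GN0) m2).
rewrite (ge0_integralZl_EFin mu measurableT (fun t _ => G0 t) mG)//.
rewrite (ge0_integralZl_EFin mu measurableT (fun t _ => GN0 t) mGN)//.
rewrite ge0_integral_opp// -ge0_muleDl// -EFinD.
by rewrite (_ : 2^-1 + 2^-1 = 1) ?mul1e//; field.
Qed.

(** Equivalent to [cL1], but stated by components so that the linearity of the real integral applies
    directly. *)
Definition cintegrable (f : R -> R[i]) : Prop :=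
  mu.-integrable [set: R] (fun t => (complex.Re (f t))%:E) /\
  mu.-integrable [set: R] (fun t => (complex.Im (f t))%:E).

Lemma cmod_ge0 (z : R[i]) : 0 <= cmod z.
Proof. by case: z => a b; exact: sqrtr_ge0. Qed.

Lemma normr_Re_le (z : R[i]) : `|complex.Re z| <= cmod z.
Proof.
rewrite -(@ler_pXn2r _ 2)// ?nnegrE ?cmod_ge0//.
by rewrite real_normK ?num_real// cmod_sqE lerDl sqr_ge0.
Qed.

Lemma normr_Im_le (z : R[i]) : `|complex.Im z| <= cmod z.
Proof.
rewrite -(@ler_pXn2r _ 2)// ?nnegrE ?cmod_ge0//.
by rewrite real_normK ?num_real// cmod_sqE lerDr sqr_ge0.
Qed.

Lemma cmod_le (z : R[i]) : cmod z <= `|complex.Re z| + `|complex.Im z|.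
Proof.
rewrite -(@ler_pXn2r _ 2)// ?nnegrE ?cmod_ge0// ?addr_ge0//.
rewrite cmod_sqE sqrrD !real_normK ?num_real// addrAC lerDl.
by rewrite mulrn_wge0// mulr_ge0.
Qed.

Lemma measurable_cmod (f : R -> R[i]) : cmeasurable f ->
  measurable_fun [set: R] (fun t => cmod (f t)).
Proof.
move=> [mr mi].
rewrite (_ : (fun _ => _) = (fun t => Num.sqrt
    (complex.Re (f t) ^+ 2 + complex.Im (f t) ^+ 2))); last first.
  by apply/funext => t; case: (f t).
apply: (measurableT_comp (f := @Num.sqrt R)).
  by apply: continuous_measurable_fun; exact: sqrt_continuous.
by apply: measurable_funD; exact: measurable_funX.
Qed.

Lemma cL1_cintegrable (f : R -> R[i]) : cL1 f -> cintegrable f.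
Proof.
move=> [mf f1].
have i1 : mu.-integrable [set: R] (fun t => (cmod (f t))%:E).
  apply/integrableP; split; first by apply/measurable_EFinP; exact: measurable_cmod.
  by under eq_integral do rewrite gee0_abs ?lee_fin ?cmod_ge0//.
case: mf => mr mi; split; apply: le_integrable i1 => //;
  try exact/measurable_EFinP; move=> t _; rewrite /= lee_fin.
- by rewrite (ger0_norm (cmod_ge0 _)) normr_Re_le.
- by rewrite (ger0_norm (cmod_ge0 _)) normr_Im_le.
Qed.

Lemma cintegrable_cL1 (f : R -> R[i]) : cintegrable f -> cL1 f.
Proof.
move=> [ir ii].
have /measurable_EFinP mr := measurable_int mu ir.
have /measurable_EFinP mi := measurable_int mu ii.
split; first by split.
have := integrableD measurableT (integrable_norm ir) (integrable_norm ii).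
move=> /integrableP[ms]; apply: le_lt_trans.
apply: ge0_le_integral => //.
- by move=> t _; rewrite lee_fin cmod_ge0.
- by apply/measurable_EFinP; exact: measurable_cmod.
- exact: measurableT_comp.
- by move=> t _; rewrite lee_fin (le_trans (cmod_le _))//= ler_norm.
Qed.

Lemma fourierE (h : R -> R[i]) (xi : R) : cintegrable h ->
  let p := fun t => complex.Re (h t) in let q := fun t => complex.Im (h t) in
  fourier h xi = (cosint p xi + sinint q xi) +i* (cosint q xi - sinint p xi).
Proof.
move=> [ip iq] p q.
have mph := measurable_phasel xi.
rewrite /fourier /cintegral /cosint /sinint.
rewrite -RintegralD ?(integrable_mul_cos ip mph) ?(integrable_mul_sin iq mph)//.
rewrite -RintegralB ?(integrable_mul_cos iq mph) ?(integrable_mul_sin ip mph)//.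
congr (_ +i* _); apply: eq_Rintegral => t _; rewrite /p /q /cexp2pi;
  case: (h t) => a b /=; rewrite mulrN cosN sinN; ring.
Qed.

Lemma measurable_fourier (h : R -> R[i]) : cintegrable h ->
  cmeasurable (fourier h).
Proof.
move=> ih; have [/(measurable_int mu)/measurable_EFinP mp
  /(measurable_int mu)/measurable_EFinP mq] := ih.
rewrite (_ : fourier h = fun xi => fourier h xi)//.
under eq_fun do rewrite (fourierE _ ih).
split => /=.
  by apply: measurable_funD; [exact: measurable_cosint|exact: measurable_sinint].
by apply: measurable_funB; [exact: measurable_cosint|exact: measurable_sinint].
Qed.

(* The cross terms of [|phat + i qhat|^2], for real p and q, are odd in xi and
   disappear when the integrand is symmetrized. *)
Lemma plancherel (h : R -> R[i]) : cL1 h -> cL2 h -> sqnorm (fourier h) = sqnorm h.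
Proof.
move=> /cL1_cintegrable ih [[mp mq] h2].
have mh := conj mp mq.
have mF := measurable_cmod_sq (measurable_fourier ih).
have [ip iq] := ih.
pose p t := complex.Re (h t); pose q t := complex.Im (h t).
have mp2 : measurable_fun [set: R] (fun t => (p t ^+ 2)%:E).
  by apply/measurable_EFinP; exact: measurable_funX.
have mq2 : measurable_fun [set: R] (fun t => (q t ^+ 2)%:E).
  by apply/measurable_EFinP; exact: measurable_funX.
have sq0 (u : R -> R) t : [set: R] t -> (0 <= (u t ^+ 2)%:E)%E.
  by move=> _; rewrite lee_fin sqr_ge0.
have hE : sqnorm h = (\int[mu]_t (p t ^+ 2)%:E + \int[mu]_t (q t ^+ 2)%:E)%E.
  rewrite -(ge0_integralD mu measurableT (sq0 p) mp2 (sq0 q) mq2).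
  by apply: eq_integral => t _; rewrite cmod_sqE EFinD.
have p2oo : (\int[mu]_t (p t ^+ 2)%:E < +oo)%E.
  apply: (le_lt_trans _ h2); rewrite -/(sqnorm h) hE leeDl//.
  by apply: integral_ge0 => t; exact: sq0.
have q2oo : (\int[mu]_t (q t ^+ 2)%:E < +oo)%E.
  apply: (le_lt_trans _ h2); rewrite -/(sqnorm h) hE leeDr//.
  by apply: integral_ge0 => t; exact: sq0.
have En0 (u : R -> R) t : [set: R] t ->
    (0 <= (cosint u t ^+ 2 + sinint u t ^+ 2)%:E)%E.
  by move=> _; rewrite lee_fin addr_ge0 ?sqr_ge0.
have mEp := measurable_energy mp; have mEq := measurable_energy mq.
move/measurable_EFinP : mEp => mEp; move/measurable_EFinP : mEq => mEq.
rewrite hE -(plancherel_real ip p2oo) -(plancherel_real iq q2oo).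
rewrite -(ge0_integralD mu measurableT (En0 p) mEp (En0 q) mEq).
rewrite /sqnorm (ge0_integral_symmetrize mF); last first.
  by move=> xi; exact: cmod_sq_ge0.
apply: eq_integral => xi _; rewrite -!EFinM -!EFinD; congr EFin.
have cosintN (u : R -> R) : cosint u (- xi) = cosint u xi.
  by apply: eq_Rintegral => t _; rewrite mulNr mulrN cosN.
have sinintN (u : R -> R) : mu.-integrable [set: R] (EFin \o u) ->
    sinint u (- xi) = - sinint u xi.
  move=> iu; rewrite -[RHS]mulN1r -RintegralZl//.
    by apply: eq_Rintegral => t _; rewrite mulNr mulrN sinN; ring.
  exact: integrable_mul_sin iu (measurable_phasel xi).
rewrite !(fourierE _ ih) !cmod_sqE/= !cosintN !sinintN//.
by rewrite -/p -/q; field.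
Qed.

End plancherel.

(** * Translations and their Fourier multipliers *)

Section translation.
Context {R : realType}.
Local Notation mu := (@lebesgue_measure R).
Implicit Types (f g h : R -> R[i]) (a : R) (z : R[i]).

Lemma ReD (x y : R[i]) : complex.Re (x + y) = complex.Re x + complex.Re y.
Proof. by case: x y => ? ? []. Qed.
Lemma ImD (x y : R[i]) : complex.Im (x + y) = complex.Im x + complex.Im y.
Proof. by case: x y => ? ? []. Qed.
Lemma ReM (x y : R[i]) : complex.Re (x * y) =
  complex.Re x * complex.Re y - complex.Im x * complex.Im y.
Proof. by case: x y => ? ? []. Qed.
Lemma ImM (x y : R[i]) : complex.Im (x * y) =
  complex.Re x * complex.Im y + complex.Im x * complex.Re y.
Proof. by case: x y => ? ? []. Qed.

Lemma cmod_sqM (x y : R[i]) : cmod (x * y) ^+ 2 = cmod x ^+ 2 * cmod y ^+ 2.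
Proof. rewrite !cmod_sqE ReM ImM; ring. Qed.

Lemma cmod_sq_cexp2pi (x : R) : cmod (cexp2pi x) ^+ 2 = 1.
Proof. by rewrite cmod_sqE cos2Dsin2. Qed.

Lemma cexp2piD (x y : R) : cexp2pi (x + y) = cexp2pi x * cexp2pi y.
Proof.
apply/eqP; rewrite eq_complex ReM ImM /cexp2pi /= mulrDr cosD sinD.
by apply/andP; split; apply/eqP; ring.
Qed.

Lemma cintegrableD f g : cintegrable f -> cintegrable g ->
  cintegrable (fun t => f t + g t).
Proof.
move=> [fr fi] [gr gi]; split.
  under eq_fun do rewrite ReD EFinD; exact: integrableD.
under eq_fun do rewrite ImD EFinD; exact: integrableD.
Qed.

Lemma cintegrableZl z f : cintegrable f -> cintegrable (fun t => z * f t).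
Proof.
move=> [fr fi]; split.
  under eq_fun do rewrite ReM EFinB !EFinM.
  exact: (integrableB measurableT (integrableZl measurableT _ fr)
                                  (integrableZl measurableT _ fi)).
under eq_fun do rewrite ImM EFinD !EFinM.
exact: (integrableD measurableT (integrableZl measurableT _ fi)
                                (integrableZl measurableT _ fr)).
Qed.

Lemma cintegralD f g : cintegrable f -> cintegrable g ->
  cintegral (fun t => f t + g t) = cintegral f + cintegral g.
Proof.
move=> [fr fi] [gr gi]; apply/eqP; rewrite eq_complex ReD ImD /=.
rewrite -RintegralD// -RintegralD//.
apply/andP; split; apply/eqP; apply: eq_Rintegral => t _; [exact: ReD|exact: ImD].
Qed.

Lemma cintegralZl z f : cintegrable f ->
  cintegral (fun t => z * f t) = z * cintegral f.
Proof.
move=> [fr fi]; apply/eqP; rewrite eq_complex ReM ImM /= -!RintegralZl//.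
rewrite -RintegralB//; [|exact: (integrableZl measurableT _ fr)
  |exact: (integrableZl measurableT _ fi)].
rewrite -RintegralD//; [|exact: (integrableZl measurableT _ fi)
  |exact: (integrableZl measurableT _ fr)].
apply/andP; split; apply/eqP; apply: eq_Rintegral => t _; [exact: ReM|exact: ImM].
Qed.

Lemma cintegrable_mul_cexp2pi h (xi : R) : cintegrable h ->
  cintegrable (fun t => h t * cexp2pi (- (xi * t))).
Proof.
move=> [ip iq].
have mph : measurable_fun [set: R] (fun t : R => 2 * pi * - (xi * t)).
  under eq_fun do rewrite -mulNr.
  by apply: measurable_phase => //; exact: measurable_cst.
split.
  under eq_fun do rewrite ReM EFinB.
  exact: (integrableB measurableT (integrable_mul_cos ip mph) (integrable_mul_sin iq mph)).
under eq_fun do rewrite ImM EFinD.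
exact: (integrableD measurableT (integrable_mul_sin ip mph) (integrable_mul_cos iq mph)).
Qed.

Lemma integrable_shift (u : R -> \bar R) a : mu.-integrable [set: R] u ->
  mu.-integrable [set: R] (fun t => u (t - a)).
Proof.
move=> iu; have := integrable_affine (- a) ltr01 iu.
by under eq_fun do rewrite mul1r.
Qed.

Lemma cintegrable_translate h a : cintegrable h -> cintegrable (translate a h).
Proof.
move=> [ip iq]; split; [exact: (integrable_shift a ip)|exact: (integrable_shift a iq)].
Qed.

Lemma cintegral_translate h a : cintegrable h -> cintegral (translate a h) = cintegral h.
Proof.
move=> [ip iq]; rewrite /cintegral /Rintegral.
rewrite (integral_affine (- a) ltr01 ip) (integral_affine (- a) ltr01 iq) !mul1e.
by congr (fine _ +i* fine _); apply: eq_integral => t _; rewrite mul1r.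
Qed.

Lemma sqnorm_translate f a : cmeasurable f -> sqnorm (translate a f) = sqnorm f.
Proof.
move=> mf; rewrite [RHS](ge0_integral_affine (- a) ltr01 (measurable_cmod_sq mf)).
  by rewrite mul1e; apply: eq_integral => t _; rewrite mul1r.
by move=> t; exact: cmod_sq_ge0.
Qed.

Lemma cmeasurable_translate f a : cmeasurable f -> cmeasurable (translate a f).
Proof.
have mshift : measurable_fun [set: R] (fun t : R => t - a).
  exact: measurable_funB.
by move=> [fr fi]; split; [exact: (measurableT_comp fr mshift)|exact: (measurableT_comp fi mshift)].
Qed.

Lemma fourier_translate h a (xi : R) : cintegrable h ->
  fourier (translate a h) xi = cexp2pi (- (xi * a)) * fourier h xi.
Proof.
move=> ih; have ihe := cintegrable_mul_cexp2pi xi ih.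
rewrite /fourier -cintegralZl// -[RHS](cintegral_translate a); last exact: cintegrableZl.
congr cintegral; apply/funext => t; rewrite /translate.
rewrite [RHS]mulrCA -cexp2piD; congr (_ * cexp2pi _); ring.
Qed.

Definition add_translate z a f : R -> R[i] := fun t => f t + z * translate a f t.

Lemma fourier_add_translate z a h xi : cintegrable h ->
  fourier (add_translate z a h) xi =
  (1 + z * cexp2pi (- (xi * a))) * fourier h xi.
Proof.
move=> ih; have ihe := cintegrable_mul_cexp2pi xi ih.
have it := cintegrable_mul_cexp2pi xi (cintegrable_translate a ih).
rewrite mulrDl mul1r -mulrA -fourier_translate// /fourier -cintegralZl//.
rewrite -cintegralD//; last exact: cintegrableZl.
by congr cintegral; apply/funext => t; rewrite /add_translate mulrDl mulrA.
Qed.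

Lemma cmeasurableZl z f : cmeasurable f -> cmeasurable (fun t => z * f t).
Proof.
move=> [fr fi]; split.
  under eq_fun do rewrite ReM.
  by apply: measurable_funB; apply: measurable_funM.
under eq_fun do rewrite ImM.
by apply: measurable_funD; apply: measurable_funM.
Qed.

Lemma cmeasurableD f g : cmeasurable f -> cmeasurable g ->
  cmeasurable (fun t => f t + g t).
Proof.
move=> [fr fi] [gr gi]; split.
  by under eq_fun do rewrite ReD; exact: measurable_funD.
by under eq_fun do rewrite ImD; exact: measurable_funD.
Qed.

Lemma cmeasurableM f g : cmeasurable f -> cmeasurable g ->
  cmeasurable (fun t => f t * g t).
Proof.
move=> [fr fi] [gr gi]; split.
  by under eq_fun do rewrite ReM; apply: measurable_funB; exact: measurable_funM.
by under eq_fun do rewrite ImM; apply: measurable_funD; exact: measurable_funM.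
Qed.

Lemma cmeasurable_add_translate z a f : cmeasurable f ->
  cmeasurable (add_translate z a f).
Proof.
by move=> mf; apply: cmeasurableD => //; apply: cmeasurableZl; exact: cmeasurable_translate.
Qed.

Lemma cmeasurable_cexp2pi a :
  cmeasurable (fun xi : R => cexp2pi (- (xi * a))).
Proof.
have mph : measurable_fun [set: R] (fun t : R => 2 * pi * - (t * a)).
  under eq_fun do rewrite -mulrN.
  by apply: measurable_phase => //; exact: measurable_cst.
by split; [exact: (measurableT_comp measurable_cos mph)
          |exact: (measurableT_comp measurable_sin mph)].
Qed.

Lemma cmod_sqD_le z (x y : R[i]) : cmod z ^+ 2 = 1 ->
  cmod (x + z * y) ^+ 2 <= 2 * cmod x ^+ 2 + 2 * cmod y ^+ 2.
Proof.
move=> z1; have -> : cmod y ^+ 2 = cmod (z * y) ^+ 2 by rewrite cmod_sqM z1 mul1r.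
move: (z * y) => w; rewrite !cmod_sqE ReD ImD.
have := sqr_ge0 (complex.Re x - complex.Re w).
have := sqr_ge0 (complex.Im x - complex.Im w); nra.
Qed.

(** What matters is the L2 continuity of f |-> f + z f_a. The constant is 2 + 2, from |x + z y|^2 <=
    2 |x|^2 + 2 |y|^2 and the translation invariance of the norm. *)
Lemma sqnorm_add_translate_le z a f : cmod z ^+ 2 = 1 -> cmeasurable f ->
  (sqnorm (add_translate z a f) <= 4%:E * sqnorm f)%E.
Proof.
move=> z1 mf.
have m1 := measurable_cmod_sq mf.
have m2 := measurable_cmod_sq (cmeasurable_translate a mf).
have s0 g t : [set: R] t -> (0 <= (cmod (g t) ^+ 2)%:E)%E.
  by move=> _; exact: cmod_sq_ge0.
have -> : (4%:E * sqnorm f = 2%:E * sqnorm f + 2%:E * sqnorm (translate a f))%E.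
  rewrite sqnorm_translate// -ge0_muleDl// -EFinD; congr (_%:E * _)%E; ring.
rewrite /sqnorm -(ge0_integralZl_EFin mu measurableT (s0 f) m1)//.
rewrite -(ge0_integralZl_EFin mu measurableT (s0 (translate a f)) m2)//.
have s2 g t : [set: R] t -> (0 <= 2%:E * (cmod (g t) ^+ 2)%:E)%E.
  by move=> _; rewrite mule_ge0 ?cmod_sq_ge0.
have m1' : measurable_fun [set: R] (fun t => 2%:E * (cmod (f t) ^+ 2)%:E)%E.
  exact: emeasurable_funM.
have m2' : measurable_fun [set: R]
    (fun t => 2%:E * (cmod (translate a f t) ^+ 2)%:E)%E.
  exact: emeasurable_funM.
rewrite -(ge0_integralD mu measurableT (s2 f) m1' (s2 (translate a f)) m2').
apply: ge0_le_integral => //.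
- by move=> t _; exact: cmod_sq_ge0.
- exact: (measurable_cmod_sq (cmeasurable_add_translate z a mf)).
- exact: emeasurable_funD.
- by move=> t _; rewrite -!EFinM -EFinD lee_fin cmod_sqD_le.
Qed.

(** The counterpart on the Fourier side: the multiplier has modulus at most 2. *)
Lemma sqnorm_mul1D_le z a g : cmod z ^+ 2 = 1 -> cmeasurable g ->
  (sqnorm (fun xi => (1 + z * cexp2pi (- (xi * a))) * g xi)%R <= 4%:E * sqnorm g)%E.
Proof.
move=> z1 mg; have m1 := measurable_cmod_sq mg.
rewrite /sqnorm -(ge0_integralZl_EFin mu measurableT (fun t _ => cmod_sq_ge0 (g t)) m1)//.
have mm : cmeasurable (fun xi => (1 + z * cexp2pi (- (xi * a))) * g xi).
  apply: cmeasurableM => //; apply: cmeasurableD.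
    by split; exact: measurable_cst.
  by apply: cmeasurableZl; exact: cmeasurable_cexp2pi.
apply: ge0_le_integral => //.
- by move=> t _; exact: cmod_sq_ge0.
- exact: (measurable_cmod_sq mm).
- exact: emeasurable_funM.
move=> t _; rewrite -EFinM lee_fin mulrDl mul1r -mulrA.
rewrite (le_trans (cmod_sqD_le _ _ z1))// cmod_sqM cmod_sq_cexp2pi mul1r; lra.
Qed.

End translation.

(** * From a zero of the transform to the inequality, and Plancherel for the L2 transform *)

Section uncertainty.
Context {R : realType}.
Local Notation mu := (@lebesgue_measure R).

Lemma integrable_cmod_sq (f : R -> R[i]) : cL2 f ->
  mu.-integrable [set: R] (fun t => (cmod (f t) ^+ 2)%:E).
Proof.
move=> [mf f2]; apply/integrableP; split; first exact: measurable_cmod_sq.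
by under eq_integral do rewrite gee0_abs ?cmod_sq_ge0//.
Qed.

Lemma dispersion_ge0 (q : R) (u : R -> R) : (forall t, 0 <= u t) ->
  (0 <= dispersion q u)%E.
Proof.
move=> u0; apply: le_ereal_inf_tmp => _ [t0 _ <-].
by apply: integral_ge0 => t _; rewrite lee_fin mulr_ge0// powR_ge0.
Qed.

(** A zero at a bounds [first_zero u] by |a|, and the power q > 0 is monotone. If u vanishes almost
    everywhere, the left side is 0. *)
Lemma property_P_fourier_zero (q kappa : R) (u : R -> R) (a : R) : 0 < q ->
  property_P q kappa -> mu.-integrable [set: R] (EFin \o u) ->
  (forall t, 0 <= u t) -> fourier (fun t => (u t)%:C) a = 0 ->
  (kappa%:E * \int[mu]_t (u t)%:E <= (`|a| `^ q)%:E * dispersion q u)%E.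
Proof.
move=> q0 P iu u0 ua.
have rhs0 : (0 <= (`|a| `^ q)%:E * dispersion q u)%E.
  by rewrite mule_ge0 ?dispersion_ge0 ?lee_fin ?powR_ge0.
have mEu := measurable_int mu iu.
have [u_ae0|u_ae] := pselect {ae mu, forall t, u t = 0}.
  rewrite (_ : (\int[mu]_t (u t)%:E = 0)%E) ?mule0//.
  rewrite -(integral0 mu [set: R]); apply: ae_eq_integral => //.
  have [N [mN N0 uN]] := u_ae0; exists N; split => //.
  by apply: subset_trans uN => t /= + ut; apply => _; rewrite ut.
(* At 0 the transform is the integral of u, and a non-negative function of zero integral vanishes
   almost everywhere, a case already settled. *)
have a0 : a != 0.
  apply/eqP => a0; apply: u_ae; move: ua; rewrite a0.
  move=> /(congr1 (@complex.Re R)); rewrite /fourier /cintegral/=.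
  under eq_Rintegral do rewrite mul0r oppr0 /cexp2pi mulr0 cos0 sin0/= mulr1 mul0r subr0.
  rewrite /Rintegral => /eqP; rewrite fine_eq0; last exact: integrable_fin_num.
  move=> /eqP I0.
  have : (\int[mu]_t `|(EFin \o u) t| = 0)%E.
    by rewrite -[RHS]I0; apply: eq_integral => t _; rewrite gee0_abs ?lee_fin.
  move=> /(ae_eq_integral_abs mu measurableT mEu)[N [mN N0 uN]].
  exists N; split => //; apply: subset_trans uN => t /= ut ut'; apply: ut.
  by have := ut' I => -[].
apply: (le_trans (P u iu u0 u_ae)).
apply: lee_wpmul2r; first exact: dispersion_ge0.
rewrite -poweR_EFin; apply: (gt0_ler_poweR (ltW q0)).
- rewrite in_itv/= leey andbT; apply: le_ereal_inf_tmp => _ [xi [xi0 _] <-].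
  by rewrite lee_fin ltW.
- by rewrite in_itv/= leey andbT lee_fin.
(* |a| belongs to the set whatever the sign of a, since zeros at xi and at - xi both count. *)
- apply: ge_ereal_inf; exists `|a|%:E => //; exists `|a| => //.
  split; first by rewrite normr_gt0.
  have [a1|a1] := leP 0 a; first by left; rewrite ger0_norm.
  by right; rewrite ltr0_norm// opprK.
Qed.

(** Adding z times the translate, and multiplying by 1 + z e^(-2 i pi a xi), are both bounded on L2,
    so they send the sequence approximating f and fhat to one approximating the two sides; on the
    sequence itself Plancherel applies. *)
Lemma sqnorm_fourier_L2_add_translate (z : R[i]) (a : R) (f fhat : R -> R[i]) :
  cmod z ^+ 2 = 1 -> cmeasurable f -> is_fourier_L2 f fhat ->
  sqnorm (add_translate z a f) =
  sqnorm (fun xi => (1 + z * cexp2pi (- (xi * a))) * fhat xi).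
Proof.
move=> z1 mf [[mg g2] [h [h12 hf hg]]].
have me : cmeasurable (fun xi => 1 + z * cexp2pi (- (xi * a)) : R[i]).
  apply: cmeasurableD; first by split; exact: measurable_cst.
  by apply: cmeasurableZl; exact: cmeasurable_cexp2pi.
apply: eq_sqnorm_approx.
- exact: cmeasurable_add_translate.
- exact: cmeasurableM.
(* The tolerance e / 4 absorbs the constant 4 of both continuity bounds. *)
move=> e e0; have e4 : 0 < e / 4 by rewrite divr_gt0.
have [n [hfn hgn]] := filter_ex (filterI (cvge0_near_le e4 hf) (cvge0_near_le e4 hg)).
have [hn1 [mh hn2]] := h12 n.
have ih := cL1_cintegrable hn1.
have mFh := measurable_fourier ih.
have le_e (x : \bar R) : (x <= (e / 4)%:E -> 4%:E * x <= e%:E)%E.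
  move=> xe; rewrite (le_trans (lee_wpmul2l _ xe))// -EFinM lee_fin mulrC divfK//.
exists (add_translate z a (h n)),
  (fun xi => (1 + z * cexp2pi (- (xi * a))) * fourier (h n) xi); split.
- exact: cmeasurable_add_translate.
- exact: cmeasurableM.
- apply: le_trans (le_e _ hfn).
  apply: le_trans (sqnorm_add_translate_le a z1 (cmeasurableB mh mf)).
  rewrite le_eqVlt; apply/orP; left; apply/eqP; congr sqnorm; apply/funext => t.
  by rewrite /add_translate /translate; ring.
- apply: le_trans (le_e _ hgn).
  apply: le_trans (sqnorm_mul1D_le a z1 (cmeasurableB mFh mg)).
  rewrite le_eqVlt; apply/orP; left; apply/eqP; congr sqnorm; apply/funext => xi.
  by rewrite mulrBr.
- have iT : cintegrable (add_translate z a (h n)).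
    by apply: cintegrableD => //; apply: cintegrableZl; exact: cintegrable_translate.
  rewrite -(plancherel (cintegrable_cL1 iT)).
    by congr sqnorm; apply/funext => xi; rewrite fourier_add_translate.
  split; first exact: cmeasurable_add_translate.
  apply: le_lt_trans (sqnorm_add_translate_le a z1 mh) _.
  by rewrite lte_mul_pinfty.
Qed.

Lemma sqnorm_fourier_L2 (f fhat : R -> R[i]) : cmeasurable f ->
  is_fourier_L2 f fhat -> sqnorm f = sqnorm fhat.
Proof.
move=> mf [[mg g2] [h [h12 hf hg]]]; apply: eq_sqnorm_approx => // e e0.
have [n [hfn hgn]] := filter_ex (filterI (cvge0_near_le e0 hf) (cvge0_near_le e0 hg)).
have [hn1 hn2] := h12 n.
exists (h n), (fourier (h n)); split => //; first by case: hn2.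
- exact: measurable_fourier (cL1_cintegrable hn1).
- by rewrite plancherel.
Qed.

End uncertainty.

(** * Orthogonality of translates seen on the Fourier side *)

Section orthogonal_translates.
Context {R : realType}.
Local Notation mu := (@lebesgue_measure R).

Lemma Rintegral_combination (A B C : R -> R) (r s : R) :
  mu.-integrable [set: R] (EFin \o A) -> mu.-integrable [set: R] (EFin \o B) ->
  mu.-integrable [set: R] (EFin \o C) ->
  \int[mu]_t (A t + (r * B t + s * C t)) =
  \int[mu]_t A t + (r * \int[mu]_t B t + s * \int[mu]_t C t).
Proof.
move=> iA iB iC.
have iB' : mu.-integrable [set: R] (EFin \o (fun t => r * B t)).
  exact: (integrableZl measurableT r iB).
have iC' : mu.-integrable [set: R] (EFin \o (fun t => s * C t)).
  exact: (integrableZl measurableT s iC).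
rewrite RintegralD//; last exact: (integrableD measurableT iB' iC').
by rewrite RintegralD// !RintegralZl.
Qed.

Lemma cmod_sqD_unimodular (r s : R) (x y : R[i]) : r ^+ 2 + s ^+ 2 = 1 ->
  cmod (x + (r +i* s) * y) ^+ 2 = cmod x ^+ 2 + cmod y ^+ 2 +
    (2 * r * complex.Re (x * y^*) + 2 * s * complex.Im (x * y^*)).
Proof.
case: x y => [x1 x2] [y1 y2] rs.
rewrite !cmod_sqE !(ReD, ImD, ReM, ImM) /=.
have -> : y1 ^+ 2 + y2 ^+ 2 = (r ^+ 2 + s ^+ 2) * (y1 ^+ 2 + y2 ^+ 2).
  by rewrite rs mul1r.
ring.
Qed.

Lemma cintegrable_mul_conj (f g : R -> R[i]) : cL2 f -> cL2 g ->
  cintegrable (fun t => f t * (g t)^*).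
Proof.
move=> f2 g2.
have := integrableD measurableT (integrable_cmod_sq f2) (integrable_cmod_sq g2).
move: f2 g2 => [mf _] [mg _] ifg.
have mgc : cmeasurable (fun t => (g t)^*).
  have ReJ (x : R[i]) : complex.Re x^* = complex.Re x by case: x.
  have ImJ (x : R[i]) : complex.Im x^* = - complex.Im x by case: x.
  case: mg => mr mi; split; first by under eq_fun do rewrite ReJ.
  by under eq_fun do rewrite ImJ; exact: measurable_funN.
have [mr mi] := cmeasurableM mf mgc.
have dom (x y : R[i]) :
    `|complex.Re (x * y^*)| <= cmod x ^+ 2 + cmod y ^+ 2 /\
    `|complex.Im (x * y^*)| <= cmod x ^+ 2 + cmod y ^+ 2.
  case: x y => [a b] [c d]; rewrite ReM ImM !cmod_sqE /= !ler_norml.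
  have := sqr_ge0 (a - c); have := sqr_ge0 (a + c).
  have := sqr_ge0 (b - d); have := sqr_ge0 (b + d).
  have := sqr_ge0 (a - d); have := sqr_ge0 (a + d).
  have := sqr_ge0 (b - c); have := sqr_ge0 (b + c).
  by move=> *; split; apply/andP; split; nra.
split; apply: le_integrable ifg => //; try exact/measurable_EFinP;
  move=> t _; rewrite lee_fin; apply: le_trans (ler_norm _).
- by have [] := dom (f t) (g t).
- by have [] := dom (f t) (g t).
Qed.

Lemma cL2_translate (f : R -> R[i]) (a : R) : cL2 f -> cL2 (translate a f).
Proof.
move=> [mf f2]; split; first exact: cmeasurable_translate.
by rewrite -/(sqnorm _) sqnorm_translate.
Qed.

Lemma fourier_cmod_sq_eq0 (f fhat : R -> R[i]) (a : R) : cL2 f ->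
  is_fourier_L2 f fhat -> orthogonal_L2 f (translate a f) ->
  fourier (fun xi => (cmod (fhat xi) ^+ 2)%:C) a = 0.
Proof.
move=> f2 ff orth; have [mf _] := f2; have [g2 _] := ff.
have Tf2 := cL2_translate a f2.
have iN := integrable_cmod_sq f2; have iT := integrable_cmod_sq Tf2.
have iM := integrable_cmod_sq g2.
have [iwr iwi] := cintegrable_mul_conj f2 Tf2.
have [wr0 wi0] : \int[mu]_t complex.Re (f t * (translate a f t)^*) = 0 /\
    \int[mu]_t complex.Im (f t * (translate a f t)^*) = 0.
  by move: orth; rewrite /orthogonal_L2 /cintegral => -[-> ->].
set N := \int[mu]_t (cmod (f t) ^+ 2).
have TN : \int[mu]_t (cmod (translate a f t) ^+ 2) = N.
  exact: (congr1 (@fine R) (sqnorm_translate a mf)).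
have MN : \int[mu]_xi (cmod (fhat xi) ^+ 2) = N.
  exact: (congr1 (@fine R) (esym (sqnorm_fourier_L2 mf ff))).
have mph : measurable_fun [set: R] (fun t : R => 2 * pi * - (t * a)).
  under eq_fun do rewrite -mulrN.
  by apply: measurable_phase => //; exact: measurable_cst.
have iX := integrable_mul_cos iM mph; have iY := integrable_mul_sin iM mph.
(* X + i Y is the transform of |fhat|^2 at a. *)
pose X := \int[mu]_xi (cmod (fhat xi) ^+ 2 * cos (2 * pi * - (xi * a))).
pose Y := \int[mu]_xi (cmod (fhat xi) ^+ 2 * sin (2 * pi * - (xi * a))).
(* For z = r + i s of modulus 1, orthogonality leaves 2 N on the side of f, while |1 + z e^(-2 i pi
   a xi)|^2 = 2 + 2 Re(z e^(-2 i pi a xi)) gives 2 N + 2 (r X - s Y) on the side of fhat. *)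
have key (r s : R) : r ^+ 2 + s ^+ 2 = 1 -> r * X - s * Y = 0.
  move=> rs; have z1 : cmod (r +i* s) ^+ 2 = 1 by rewrite cmod_sqE.
  have := congr1 (@fine R) (sqnorm_fourier_L2_add_translate a z1 mf ff).
  have -> : fine (sqnorm (add_translate (r +i* s) a f)) = N + N.
    transitivity (\int[mu]_t ((cmod (f t) ^+ 2 + cmod (translate a f t) ^+ 2) +
        ((2 * r) * complex.Re (f t * (translate a f t)^*)
         + (2 * s) * complex.Im (f t * (translate a f t)^*)))).
      by apply: eq_Rintegral => t _; rewrite /add_translate cmod_sqD_unimodular.
    have iNT : mu.-integrable [set: R]
        (EFin \o (fun t => cmod (f t) ^+ 2 + cmod (translate a f t) ^+ 2)).
      exact: (integrableD measurableT iN iT).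
    have /= -> := Rintegral_combination (2 * r) (2 * s) iNT iwr iwi.
    by rewrite wr0 wi0 !mulr0 !addr0 RintegralD// TN.
  have -> : fine (sqnorm (fun xi => (1 + (r +i* s) * cexp2pi (- (xi * a))) * fhat xi)) =
      N + N + (2 * r * X + (- (2 * s)) * Y).
    transitivity (\int[mu]_xi ((cmod (fhat xi) ^+ 2 + cmod (fhat xi) ^+ 2) +
        ((2 * r) * (cmod (fhat xi) ^+ 2 * cos (2 * pi * - (xi * a))) +
         (- (2 * s)) * (cmod (fhat xi) ^+ 2 * sin (2 * pi * - (xi * a)))))).
      apply: eq_Rintegral => xi _; rewrite cmod_sqM.
      move: (cmod (fhat xi) ^+ 2) => m; rewrite cmod_sqE ReD ImD ReM ImM /=.
      have := cos2Dsin2 (2 * pi * - (xi * a)).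
      move: (cos _) (sin _) => C S CS.
      have -> : (1 + (r * C - s * S)) ^+ 2 + (0 + (r * S + s * C)) ^+ 2 =
        1 + 2 * (r * C - s * S) + (r ^+ 2 + s ^+ 2) * (C ^+ 2 + S ^+ 2) by ring.
      by rewrite CS rs; ring.
    have iMM : mu.-integrable [set: R]
        (EFin \o (fun xi => cmod (fhat xi) ^+ 2 + cmod (fhat xi) ^+ 2)).
      exact: (integrableD measurableT iM iM).
    have /= -> := Rintegral_combination (2 * r) (- (2 * s)) iMM iX iY.
    by rewrite RintegralD// MN.
  lra.
have X0 : X = 0 by have := key 1 0; rewrite expr1n expr0n addr0 => /(_ erefl); lra.
have Y0 : Y = 0 by have := key 0 1; rewrite expr1n expr0n add0r => /(_ erefl); lra.
rewrite /fourier /cintegral.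
transitivity (X +i* Y); last by rewrite X0 Y0.
congr (_ +i* _); apply: eq_Rintegral => xi _; rewrite /cexp2pi [a * xi]mulrC/=; ring.
Qed.

End orthogonal_translates.

Theorem corollary2p2 (R : realType) (q kappa : R) (q_gt0 : 0 < q)
    (kappa_gt0 : 0 < kappa) (Pkappa : property_P q kappa)
    (f : R -> R[i]) (fL2 : cL2 f) :
  (forall fhat : R -> R[i], is_fourier_L2 f fhat ->
     cL2 (fun xi : R => ((1 + `|xi|) `^ (q / 2))%:C * fhat xi) ->
     forall a : R, orthogonal_L2 f (translate a f) ->
     (kappa%:E * \int[lebesgue_measure]_t (cmod (f t) ^+ 2)%:E <=
      (`|a| `^ q)%:E * dispersion q (fun xi : R => (cmod (fhat xi) ^+ 2)%R))%E)
  /\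
  (cL2 (fun t : R => ((1 + `|t|) `^ (q / 2))%:C * f t) ->
   forall w : R, orthogonal_L2 f (modulate w f) ->
   (kappa%:E * \int[lebesgue_measure]_t (cmod (f t) ^+ 2)%:E <=
    (`|w| `^ q)%:E * dispersion q (fun t : R => (cmod (f t) ^+ 2)%R))%E).
Proof.
split=> [fhat ff _ a orth|_ w orth].
  (* The property will be applied to |fhat|^2, whose mass therefore replaces that of |f|^2. *)
  rewrite -/(sqnorm f) (sqnorm_fourier_L2 fL2.1 ff).
  apply: property_P_fourier_zero => //.
  - exact: integrable_cmod_sq ff.1.
  - by move=> t; exact: sqr_ge0.
  - exact: (fourier_cmod_sq_eq0 fL2 ff orth).
apply: property_P_fourier_zero => //.
- exact: integrable_cmod_sq.
- by move=> t; exact: sqr_ge0.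
(* Conjugating the modulated factor produces e^(-2 i pi w t), so the two integrands agree
   pointwise. *)
rewrite -[RHS]orth; congr cintegral; apply/funext => t.
rewrite /modulate; case: (f t) => x y.
apply/eqP; rewrite eq_complex /cexp2pi !(ReM, ImM) cmod_sqE /= mulrN cosN sinN.
by apply/andP; split; apply/eqP; ring.
Qed.
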